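(* Let $f\colon \mathbb T^d\to\mathbb C$ be a fixed function and let $\boldsymbol X_M = \{\boldsymbol x^1,\dots,\boldsymbol x^M\}\subset\mathbb T^d$ be a reconstructing rank-1 lattice for a (finite) frequency set $I_M\subset\mathbb Z^d$. Further, let $\emptyset\neq I\subset I_M$, $t>0$, and let $n\in\mathbb N$ be such that $n\ge 12|I|(\log|I|+t)$. Let $\boldsymbol X=\{\boldsymbol x^i\}_{i\in J}$, $|J|=n$, be a collection of $n$ points drawn i.i.d. and uniformly from $\boldsymbol X_M$. Then, with probability exceeding $1-2\exp(-t)$, \begin{align*} \|f-S_{\boldsymbol X}f\|_{L_2}^2 &\le \Big(3\|f-P_If\|_{L_2}+\sqrt{\tfrac{2}{9|I|}}\,\|P_{I_M}f-P_If\|_\infty\Big)^2+4\|f-P_{I_M}f\|_\infty^2\\ &\le \Big(3+\sqrt{\tfrac{2|I_M\setminus I|}{9|I|}}\Big)^2\|f-P_If\|_{L_2}^2+4\|f-P_{I_M}f\|_\infty^2 . \end{align*}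
   Context: $\mathbb T=\mathbb R/\mathbb Z$ is the torus, $\mathbb T^d$ carries the uniform (Haar) probability measure, and $L_2=L_2(\mathbb T^d)$. The function $f$ is everywhere defined and square integrable, so that point evaluations and Fourier coefficients $\hat f_{\boldsymbol k}=\langle f,\exp(2\pi\mathrm i\langle\boldsymbol k,\cdot\rangle)\rangle_{L_2}$, $\boldsymbol k\in\mathbb Z^d$, make sense; $\|\cdot\|_\infty$ is the supremum norm on $\mathbb T^d$. For $I\subset\mathbb Z^d$, $P_If=\sum_{\boldsymbol k\in I}\hat f_{\boldsymbol k}\exp(2\pi\mathrm i\langle\boldsymbol k,\cdot\rangle)$ is the $L_2$-orthogonal projection onto the frequencies in $I$. Rank-1 lattice: for a generating vector $\boldsymbol z\in\mathbb R^d$ and a lattice size $M\in\mathbb N$, the point set $\boldsymbol X_M=\{\frac1M(i\boldsymbol z \bmod M\mathbf 1)\in\mathbb T^d: i=0,\dots,M-1\}$ (modulus taken entrywise), with points enumerated as $\boldsymbol x^1,\dots,\boldsymbol x^M$. It has the reconstructing property for a frequency set $K\subset\mathbb Z^d$ (is a reconstructing rank-1 lattice for $K$) if $\frac1M\sum_{i=1}^M\exp(2\pi\mathrm i\langle\boldsymbol k,\boldsymbol x^i\rangle)=\delta_{\boldsymbol 0,\boldsymbol k}$ for all $\boldsymbol k\in\mathcal D(K)=\{\boldsymbol k-\boldsymbol l:\boldsymbol k,\boldsymbol l\in K\}$. Least squares approximation: for the collection $\boldsymbol X=\{\boldsymbol x^i\}_{i\in J}$ (points counted with multiplicity if drawn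 repeatedly), $S_{\boldsymbol X}f=\arg\min_{g\in V}\sum_{i\in J}|g(\boldsymbol x^i)-f(\boldsymbol x^i)|^2$ with $V=\operatorname{span}\{\exp(2\pi\mathrm i\langle\boldsymbol k,\cdot\rangle)\}_{\boldsymbol k\in I}$; its coefficient vector is $(\boldsymbol L^*\boldsymbol L)^{-1}\boldsymbol L^*\boldsymbol f$, where $\boldsymbol L=(\exp(2\pi\mathrm i\langle\boldsymbol k,\boldsymbol x^i\rangle))_{i\in J,\boldsymbol k\in I}$ and $\boldsymbol f=(f(\boldsymbol x^i))_{i\in J}$. *)

(* Defs.v *)
From HB Require Import structures.
From mathcomp Require Import all_boot all_order all_algebra finmap.
From mathcomp Require Import all_classical all_reals all_analysis.
From mathcomp Require Import complex.

Set Implicit Arguments.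
Unset Strict Implicit.
Unset Printing Implicit Defensive.

Import Order.TTheory GRing.Theory Num.Theory.
Import numFieldNormedType.Exports.
Import Normc.

Local Open Scope classical_set_scope.
Local Open Scope complex_scope.
Local Open Scope ring_scope.

(* A function on the torus T^d = R^d / Z^d is a Z^d-periodic function on R^d,
   where R^d is [d.-tuple R] with its product (Borel) sigma-algebra. *)
Definition torus_function (R : realType) (d : nat) (f : d.-tuple R -> R[i]) :=
  forall (x : d.-tuple R) (m : 'I_d -> int),
    f [tuple tnth x j + (m j)%:~R | j < d] = f x.

Section haar.
Context {R : realType}.

(* The library's measures on R live on [measurableTypeR R], whose sigma-algebra
   is that of R but with another display; hence the type of x. *)
Definition consp (d : nat) (x : measurableTypeR R * d.-tuple R)
    : d.+1.-tuple R :=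
  [tuple of (x.1 : R) :: x.2].

Lemma measurable_consp d : measurable_fun setT (@consp d).
Proof.
apply: (@measurable_cons _ _ _ _ (fun x => x.1 : R) d snd).
  exact: (@measurable_fst _ _ (measurableTypeR R) (d.-tuple R)).
exact: measurable_snd.
Qed.

HB.instance Definition _ d :=
  isMeasurableFun.Build _ _ _ _ (@consp d) (@measurable_consp d).

(* The Haar probability measure of T^d, carried by the fundamental domain
   [0, 1]^d: the d-fold product of the uniform distribution on [0, 1]. *)
Fixpoint haar (d : nat) : probability (d.-tuple R) R :=
  if d is d'.+1 then
    distribution (uniform_prob (@ltr01 R) \x haar d')%E (@consp d')
  else \d_([tuple] : 0.-tuple R).

End haar.

Section fourier.
Context {R : realType} {d : nat}.
Implicit Types (f g : d.-tuple R -> R[i]) (k : 'rV[int]_d) (x : d.-tuple R).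

Definition cmeasurable f :=
  measurable_fun setT (fun x => complex.Re (f x)) /\
  measurable_fun setT (fun x => complex.Im (f x)).

Definition cintegral f : R[i] :=
  (\int[haar d]_x complex.Re (f x)) +i* (\int[haar d]_x complex.Im (f x)).

Definition L2norm f : \bar R :=
  'N[haar d]_2%:E[EFin \o (@normc R \o f)]%E.

(* True supremum over all points, not the essential supremum; it may be +oo. *)
Definition supnorm f : \bar R := ereal_sup [set (normc (f x))%:E | x in setT].

Definition square_integrable f := cmeasurable f /\ (L2norm f < +oo)%E.

(* exp(2 pi i <k, x>) *)
Definition character k x : R[i] :=
  let theta := 2 * pi * \sum_(j < d) (k 0 j)%:~R * tnth x j in
  cos theta +i* sin theta.

Definition fourier_coef f k : R[i] :=
  cintegral (fun x => f x * conjc (character k x)).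

Definition fourier_proj (I : {fset 'rV[int]_d}) f x : R[i] :=
  \sum_(k <- I) fourier_coef f k * character k x.

Definition trig_span (I : {fset 'rV[int]_d}) : set (d.-tuple R -> R[i]) :=
  [set g | exists c : 'rV[int]_d -> R[i],
     g = fun x => \sum_(k <- I) c k * character k x].

Definition residual n (X : 'I_n -> d.-tuple R) f g : R :=
  \sum_(j < n) normc (g (X j) - f (X j)) ^+ 2.

(* The set of all minimizers; S_X f is its element when it has only one, i.e.
   when the matrix (character k (X j))_{j, k} has full column rank. *)
Definition least_squares n (X : 'I_n -> d.-tuple R) (I : {fset 'rV[int]_d}) f
    : set (d.-tuple R -> R[i]) :=
  [set g | trig_span I g /\
     forall h, trig_span I h -> residual X f g <= residual X f h].

End fourier.

Arguments L2norm {R d} f%_R.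
Arguments supnorm {R d} f%_R.

Section lattice.
Context {R : realType} {d : nat}.

(* a mod b, with values in [0, b) *)
Definition rmod (a b : R) : R := a - b * (Num.floor (a / b))%:~R.

Definition lattice_point (z : 'rV[R]_d) (M i : nat) : d.-tuple R :=
  [tuple M%:R^-1 * rmod (i%:R * z 0 j) M%:R | j < d].

Definition difference_set (K : {fset 'rV[int]_d}) : {fset 'rV[int]_d} :=
  [fset k - l | k in K, l in K]%fset.

Definition reconstructing (z : 'rV[R]_d) (M : nat) (K : {fset 'rV[int]_d}) :=
  forall k, k \in difference_set K ->
    M%:R^-1 * \sum_(i < M) character k (lattice_point z M i)
      = (k == 0)%:R :> R[i].

End lattice.

Definition mutually_independent (dO dT : measure_display) (Omega : measurableType dO)
    (T : measurableType dT) (R : realType) (P : probability Omega R)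
    (n : nat) (X : 'I_n -> {RV P >-> T}) :=
  forall (J : {set 'I_n}) (A : 'I_n -> set T),
    (forall j, measurable (A j)) ->
    P (\bigcap_(j in [set` J]) (X j @^-1` A j)) =
      (\prod_(j in J) P (X j @^-1` A j))%E.

(* Main.v *)
Require Import Defs.
From HB Require Import structures.
From mathcomp Require Import all_boot all_order all_algebra finmap.
From mathcomp Require Import all_classical all_reals all_analysis.
From mathcomp Require Import complex.
From mathcomp Require Import measurable_realfun ring lra.

Set Implicit Arguments.
Unset Strict Implicit.
Unset Printing Implicit Defensive.

Import Order.TTheory GRing.Theory Num.Theory.
Import numFieldNormedType.Exports.
Import Normc.

Local Open Scope classical_set_scope.
Local Open Scope complex_scope.
Local Open Scope ring_scope.

                                                

(** Write [m] for the size of [I], [e] for the L2 error of P_I f, [p] for P_IM f - P_I f, [a] for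
    its supremum, [b] for the supremum of f - P_IM f, and s^2 = 2 / (9 m). By the reconstructing
    property, averages over the lattice reproduce exactly the inner products of trigonometric
    polynomials with frequencies in [IM]. So for a uniformly drawn lattice point the characters of
    [IM] are orthonormal, and the mean of |p|^2 is the sum of the squared coefficients over IM \ I,
    at most e^2.

    Two events can spoil the approximation. Either the sampled Gram matrix has a unit vector of
    energy at most n / 2, which by a matrix Chernoff bound ([small_energy_card]) has probability at
    most m exp(- n / (10 m)); or 4 sum |p(x^j)|^2 exceeds n (8 e^2 + 6 s e a + s^2 a^2), which by a
    Bernstein type bound ([deviation_card]) has probability at most exp(- n / (12 m)). The sample
    size puts the first strictly below exp(- t) and the second at most there ([sample_size_tails]).
    Both bounds are obtained by counting index tuples among the M^n equally likely ones.

    Outside these events the rest is deterministic ([recovery_estimate]). The least squares problem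
    has a unique solution, and n / 2 times the squared distance of its coefficients to those of P_I
    f is at most the sum of |f - P_I f|^2 over the sample, hence at most 2 sum |p(x^j)|^2 + 2 n b^2.
    Adding e^2 ([pythagoras]) gives 9 e^2 + 6 s e a + s^2 a^2 + 4 b^2 = (3 e + s a)^2 + 4 b^2. The
    second inequality of the theorem is Cauchy-Schwarz and Bessel: a is at most e times the square
    root of |IM \ I| ([supnorm_proj_diff_le]).

    The matrix Chernoff bound avoids spectral theory and the matrix exponential: exp(- S) is
    replaced by (1 - S / N)^N with N = 2^k, Golden-Thompson by a trace inequality for powers of two
    ([retr_golden_thompson]), and the errors, of order 1 / N, vanish as k grows. *)

Section adjoint.
Context {R : rcfType}.

(** * Adjoints, real traces and a Golden-Thompson inequality for powers of two *)

Lemma ReD (x y : R[i]) : complex.Re (x + y) = complex.Re x + complex.Re y.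
Proof. by case: x; case: y. Qed.
Lemma ReB (x y : R[i]) : complex.Re (x - y) = complex.Re x - complex.Re y.
Proof. by case: x; case: y. Qed.
Lemma Re_sum (I : Type) (r : seq I) (P : pred I) (F : I -> R[i]) :
  complex.Re (\sum_(i <- r | P i) F i) = \sum_(i <- r | P i) complex.Re (F i).
Proof. exact: (big_morph _ ReD). Qed.
Lemma ReMr (a : R) (x : R[i]) : complex.Re (a%:C * x) = a * complex.Re x.
Proof. by case: x => u v /=; rewrite mul0r subr0. Qed.
Lemma Re_conjc (x : R[i]) : complex.Re (conjc x) = complex.Re x.
Proof. by case: x. Qed.
Lemma normc_sqr (x : R[i]) :
  normc x ^+ 2 = complex.Re x ^+ 2 + complex.Im x ^+ 2.
Proof. by case: x => u v /=; rewrite sqr_sqrtr// addr_ge0// sqr_ge0. Qed.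
Lemma mulcJ (x : R[i]) : x * conjc x = (normc x ^+ 2)%:C.
Proof.
by rewrite normc_sqr; case: x => u v; apply/eqP; rewrite eq_complex /=;
  apply/andP; split; apply/eqP; ring.
Qed.
Lemma normc_conjc (x : R[i]) : normc (conjc x) = normc x.
Proof. by case: x => u v /=; rewrite sqrrN. Qed.
Lemma normc_ge0 (x : R[i]) : 0 <= normc x.
Proof. by case: x => u v; exact: sqrtr_ge0. Qed.

Definition adjmx m n (M : 'M[R[i]]_(m, n)) : 'M[R[i]]_(n, m) :=
  map_mx conjc M^T.

Lemma adjmxK m n (M : 'M[R[i]]_(m, n)) : adjmx (adjmx M) = M.
Proof. by apply/matrixP => i j; rewrite !mxE conjcK. Qed.
Lemma adjmxM m n p (A : 'M[R[i]]_(m, n)) (B : 'M[R[i]]_(n, p)) :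
  adjmx (A *m B) = adjmx B *m adjmx A.
Proof. by rewrite /adjmx trmx_mul map_mxM. Qed.
Lemma adjmxD m n (A B : 'M[R[i]]_(m, n)) : adjmx (A + B) = adjmx A + adjmx B.
Proof. by rewrite /adjmx linearD /= map_mxD. Qed.
Lemma adjmxN m n (A : 'M[R[i]]_(m, n)) : adjmx (- A) = - adjmx A.
Proof. by rewrite /adjmx linearN /= map_mxN. Qed.
Lemma adjmxB m n (A B : 'M[R[i]]_(m, n)) : adjmx (A - B) = adjmx A - adjmx B.
Proof. by rewrite adjmxD adjmxN. Qed.
Lemma adjmxZ m n (a : R) (A : 'M[R[i]]_(m, n)) :
  adjmx (a%:C *: A) = a%:C *: adjmx A.
Proof. by apply/matrixP => i j; rewrite !mxE rmorphM /= oppr0. Qed.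
Lemma adjmx1 m : adjmx (1%:M : 'M[R[i]]_m) = 1%:M.
Proof. by rewrite /adjmx tr_scalar_mx map_mx1. Qed.
Lemma adjmx_sum m n (I : Type) (r : seq I) (F : I -> 'M[R[i]]_(m, n)) :
  adjmx (\sum_(i <- r) F i) = \sum_(i <- r) adjmx (F i).
Proof.
apply: (big_morph _ (@adjmxD _ _)); apply/matrixP => i j.
by rewrite !mxE conjc0.
Qed.

(** Taking the real part keeps all trace inequalities in the ordered field [R], so that no trace has
    to be proved real. *)
Definition retr m (M : 'M[R[i]]_m) : R := complex.Re (\tr M).

Lemma retrD m (A B : 'M[R[i]]_m) : retr (A + B) = retr A + retr B.
Proof. by rewrite /retr mxtraceD ReD. Qed.
Lemma retrB m (A B : 'M[R[i]]_m) : retr (A - B) = retr A - retr B.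
Proof. by rewrite /retr linearB /= ReB. Qed.
Lemma retrZ m a (A : 'M[R[i]]_m) : retr (a%:C *: A) = a * retr A.
Proof. by rewrite /retr mxtraceZ ReMr. Qed.
Lemma retrC m n (A : 'M[R[i]]_(m, n)) (B : 'M[R[i]]_(n, m)) :
  retr (A *m B) = retr (B *m A).
Proof. by rewrite /retr mxtrace_mulC. Qed.
Lemma retr_adj m (A : 'M[R[i]]_m) : retr (adjmx A) = retr A.
Proof.
by rewrite /retr /mxtrace !Re_sum; apply: eq_bigr => i _; rewrite !mxE Re_conjc.
Qed.
Lemma retr_sum m (I : Type) (r : seq I) (F : I -> 'M[R[i]]_m) :
  retr (\sum_(i <- r) F i) = \sum_(i <- r) retr (F i).
Proof. by apply: (big_morph _ (@retrD m)); rewrite /retr mxtrace0. Qed.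

Lemma retr_mulmx_adj m n (M : 'M[R[i]]_(m, n)) :
  retr (M *m adjmx M) = \sum_i \sum_j normc (M i j) ^+ 2.
Proof.
rewrite /retr /mxtrace Re_sum; apply: eq_bigr => i _.
by rewrite mxE Re_sum; apply: eq_bigr => j _; rewrite !mxE mulcJ.
Qed.

Lemma retr_mulmx_adj_ge0 m n (M : 'M[R[i]]_(m, n)) : 0 <= retr (M *m adjmx M).
Proof.
rewrite retr_mulmx_adj; apply: sumr_ge0 => i _; apply: sumr_ge0 => j _.
exact: sqr_ge0.
Qed.

Definition selfadjoint m (M : 'M[R[i]]_m) := adjmx M = M.

Lemma selfadjoint_exp m (M : 'M[R[i]]_m) k : selfadjoint M -> selfadjoint (M ^+ k).
Proof.
move=> hM; elim: k => [|k IH]; first exact: adjmx1.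
by rewrite /selfadjoint exprS -mulmxE adjmxM IH hM mulmxE -exprSr exprS.
Qed.

(** Cyclicity of the trace, since (A B)^(k+1) = A (B A)^k B. The exponent must be positive: at 0 the
    two sides are the sizes [m] and [n]. *)
Lemma retr_expC m n (A : 'M[R[i]]_(m, n)) (B : 'M[R[i]]_(n, m)) k :
  (0 < k)%N -> retr ((A *m B) ^+ k) = retr ((B *m A) ^+ k).
Proof.
case: k => // k _.
have E : forall k, (A *m B) ^+ k.+1 = A *m ((B *m A) ^+ k *m B).
  elim=> [|j IH]; first by rewrite expr0 mul1mx expr1.
  rewrite exprSr IH [(B *m A) ^+ j.+1]exprSr.
  by rewrite -!mulmxE !mulmxA.
by rewrite E retrC -mulmxA exprSr mulmxE.
Qed.

Lemma retr_mulmx_le m (P Q : 'M[R[i]]_m) : selfadjoint P -> selfadjoint Q ->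
  retr (P *m Q) <= (retr (P *m P) + retr (Q *m Q)) / 2.
Proof.
move=> hP hQ; have := retr_mulmx_adj_ge0 (P - Q).
rewrite adjmxB hP hQ mulmxBl !mulmxBr !retrB (retrC Q P); lra.
Qed.

                                                                        
(** The two inequalities are proved together by induction on [k]. The first at k + 1 applies the
    second to M = X Y: cyclicity turns X Y^2 X into X^2 Y^2, to which the first at k applies. The
    second at k + 1 applies the second at k to M^2, regroups cyclically into the product of
    [adjmx M *m M] and [M *m adjmx M], then uses the first at k and the arithmetic mean bound
    [retr_mulmx_le], whose two terms have equal trace. The base case is the nonnegativity of the
    Frobenius norm of [M - adjmx M]. *)
Lemma retr_exp_le k m :
  (forall X Y : 'M[R[i]]_m, selfadjoint X -> selfadjoint Y ->
     retr ((X *m Y) ^+ (2 ^ k)) <= retr (X ^+ (2 ^ k) *m Y ^+ (2 ^ k)))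
  /\ (forall M : 'M[R[i]]_m,
     retr (M ^+ (2 ^ k.+1)) <= retr ((M *m adjmx M) ^+ (2 ^ k))).
Proof.
elim: k => [|k [IHB IHA]].
  rewrite !expn0 expn1; split=> [X Y _ _|M]; rewrite ?expr1//.
  have := retr_mulmx_adj_ge0 (M - adjmx M).
  rewrite adjmxB adjmxK mulmxBl !mulmxBr !retrB.
  rewrite (retrC (adjmx M) M) -adjmxM retr_adj expr2 mulmxE; lra.
have k0 : (0 < 2 ^ k)%N by rewrite expn_gt0.
split=> [X Y hX hY|M].
  apply: le_trans (IHA _) _.
  have -> : X *m Y *m adjmx (X *m Y) = X *m (Y ^+ 2 *m X).
    by rewrite adjmxM hX hY expr2 -mulmxE !mulmxA.
  rewrite (retr_expC _ _ k0) -mulmxA mulmxE -expr2 -mulmxE (retr_expC _ _ k0).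
  apply: le_trans (IHB (X ^+ 2) (Y ^+ 2) _ _) _; try exact: selfadjoint_exp.
  by rewrite -!exprM expnS.
have -> : M ^+ (2 ^ k.+2) = (M *m M) ^+ (2 ^ k.+1).
  by rewrite expnS exprM expr2.
apply: le_trans (IHA _) _.
have -> : retr ((M *m M *m adjmx (M *m M)) ^+ (2 ^ k)) =
   retr ((adjmx M *m M *m (M *m adjmx M)) ^+ (2 ^ k)).
  have E : adjmx M *m (M *m M *m adjmx M) = adjmx M *m M *m (M *m adjmx M).
    by rewrite !mulmxA.
  by rewrite adjmxM mulmxA (retr_expC _ _ k0) E.
have h1 : selfadjoint (adjmx M *m M) by rewrite /selfadjoint adjmxM adjmxK.
have h2 : selfadjoint (M *m adjmx M) by rewrite /selfadjoint adjmxM adjmxK.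
apply: le_trans (IHB _ _ h1 h2) _.
apply: le_trans (retr_mulmx_le (selfadjoint_exp _ h1) (selfadjoint_exp _ h2)) _.
rewrite !mulmxE -!exprD addnn -mul2n -expnS -!mulmxE.
rewrite (retr_expC (adjmx M)) ?expn_gt0//; lra.
Qed.

Lemma retr_golden_thompson k m (X Y : 'M[R[i]]_m) :
  selfadjoint X -> selfadjoint Y ->
  retr ((X *m Y) ^+ (2 ^ k)) <= retr (X ^+ (2 ^ k) *m Y ^+ (2 ^ k)).
Proof. by move=> *; apply: (retr_exp_le k m).1. Qed.

End adjoint.

(** * Rayleigh quotients and traces of powers *)

Section quadratic_form.
Context {R : rcfType} {m : nat}.
Implicit Types (H K : 'M[R[i]]_m) (u : 'cV[R[i]]_m).

Definition qform H u : R := retr (adjmx u *m H *m u).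

Lemma qformB H K u : qform (H - K) u = qform H u - qform K u.
Proof. by rewrite /qform mulmxBr mulmxBl retrB. Qed.

Lemma qformZ a H u : qform (a%:C *: H) u = a * qform H u.
Proof. by rewrite /qform -scalemxAr -scalemxAl retrZ. Qed.

Lemma qform1 u : adjmx u *m u = 1%:M -> qform 1%:M u = 1.
Proof. by move=> u1; rewrite /qform mulmx1 u1 /retr mxtrace_scalar. Qed.

Lemma qform_ge0 H u : 0 <= qform (adjmx H *m H) u.
Proof.
have := retr_mulmx_adj_ge0 (adjmx (H *m u)).
by rewrite adjmxK adjmxM /qform !mulmxA.
Qed.

(** A variance is nonnegative: the quadratic form of (H - q)^2 at [u], where q is that of [H],
    equals the difference of the two sides. *)
Lemma qform_sqr_le H u : selfadjoint H -> adjmx u *m u = 1%:M ->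
  qform H u ^+ 2 <= qform (H ^+ 2) u.
Proof.
move=> hH u1; set q := qform H u.
have := qform_ge0 (H - q%:C *: 1%:M) u.
rewrite adjmxB adjmxZ adjmx1 hH mulmxBl !mulmxBr -!scalemxAl -!scalemxAr.
rewrite !mulmx1 !mul1mx mulmxE -expr2 !qformB !qformZ (qform1 u1) -/q.
by move: (qform (H ^+ 2) u) => w; rewrite expr2; lra.
Qed.

Lemma qform_exp_le H u k : selfadjoint H -> adjmx u *m u = 1%:M ->
  0 <= qform H u -> qform H u ^+ (2 ^ k) <= qform (H ^+ (2 ^ k)) u.
Proof.
move=> hH u1 H0; elim: k => [|k IH]; first by rewrite expn0 !expr1.
rewrite expnS mulnC !exprM.
apply: le_trans (qform_sqr_le (selfadjoint_exp _ hH) u1).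
have q0 : 0 <= qform H u ^+ (2 ^ k) by exact: exprn_ge0.
have q1 := le_trans q0 IH.
by apply: lerXn2r IH; rewrite nnegrE.
Qed.

(** The difference of the two sides is the squared Frobenius norm of [H - H *m u *m adjmx u]. This
    and [qform_exp_le] replace the argument that a trace dominates the largest eigenvalue. *)
Lemma qform_le_retr H u : adjmx u *m u = 1%:M ->
  qform (adjmx H *m H) u <= retr (adjmx H *m H).
Proof.
move=> u1; pose K := H *m u.
have E : (H - K *m adjmx u) *m adjmx (H - K *m adjmx u) =
    H *m adjmx H - K *m adjmx K.
  rewrite adjmxB adjmxM adjmxK mulmxBl !mulmxBr.
  have -> : H *m (u *m adjmx K) = K *m adjmx K by rewrite mulmxA.
  have -> : K *m adjmx u *m adjmx H = K *m adjmx K.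
    by rewrite /K [adjmx (H *m u)]adjmxM -!mulmxA.
  have -> : K *m adjmx u *m (u *m adjmx K) = K *m adjmx K.
    by rewrite -(mulmxA K) (mulmxA (adjmx u)) u1 mul1mx.
  by rewrite (subrr (K *m adjmx K)) subr0.
have := retr_mulmx_adj_ge0 (H - K *m adjmx u).
rewrite E retrB subr_ge0 (retrC H (adjmx H)) => h; apply: le_trans h.
by rewrite /qform (retrC K) /K adjmxM !mulmxA.
Qed.

Lemma qform_exp_le_retr H u k : selfadjoint H -> adjmx u *m u = 1%:M ->
  0 <= qform H u -> qform H u ^+ (2 ^ k.+1) <= retr (H ^+ (2 ^ k.+1)).
Proof.
move=> hH u1 H0; apply: le_trans (qform_exp_le _ hH u1 H0) _.
have := qform_le_retr (H ^+ (2 ^ k)) u1.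
by rewrite selfadjoint_exp// mulmxE -exprD addnn -mul2n -expnS.
Qed.

End quadratic_form.

(** * Maximal absolute row sums, used to control discretisation errors *)

Section row_norm.
Context {R : rcfType} {m : nat}.
Implicit Types (X Y : 'M[R[i]]_m) (a b : R).

Definition row_norm_le a X := forall i, \sum_j normc (X i j) <= a.

Lemma normc_sum (I : Type) (r : seq I) (F : I -> R[i]) :
  normc (\sum_(i <- r) F i) <= \sum_(i <- r) normc (F i).
Proof.
elim/big_rec2: _ => [|i x y _ h]; first by rewrite normc0.
by apply: le_trans (le_normcD _ _) _; rewrite lerD2l.
Qed.

Lemma row_norm_leD a b X Y :
  row_norm_le a X -> row_norm_le b Y -> row_norm_le (a + b) (X + Y).
Proof.
move=> hX hY i; apply: le_trans (lerD (hX i) (hY i)).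
by rewrite -big_split; apply: ler_sum => j _; rewrite mxE le_normcD.
Qed.

Lemma row_norm_leN a X : row_norm_le a X -> row_norm_le a (- X).
Proof.
move=> hX i; apply: le_trans (hX i).
by apply: ler_sum => j _; rewrite mxE normcN.
Qed.

Lemma row_norm_leB a b X Y :
  row_norm_le a X -> row_norm_le b Y -> row_norm_le (a + b) (X - Y).
Proof. by move=> hX hY; apply/row_norm_leD/row_norm_leN. Qed.

Lemma normc_real a : 0 <= a -> normc (a%:C) = a.
Proof. by move=> a0 /=; rewrite expr0n/= addr0 sqrtr_sqr ger0_norm. Qed.

Lemma row_norm_leZ a b X : 0 <= a ->
  row_norm_le b X -> row_norm_le (a * b) (a%:C *: X).
Proof.
move=> a0 hX i; apply: le_trans (ler_wpM2l a0 (hX i)).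
rewrite mulr_sumr; apply: ler_sum => j _.
by rewrite mxE normcM normc_real.
Qed.

Lemma row_norm_le1 : row_norm_le 1 1%:M.
Proof.
move=> i; rewrite (bigD1 i)//= big1 => [|j ji].
  by rewrite mxE eqxx normc1 addr0.
by rewrite mxE eq_sym (negbTE ji) normc0.
Qed.

Lemma row_norm_leM a b X Y : 0 <= b ->
  row_norm_le a X -> row_norm_le b Y -> row_norm_le (a * b) (X *m Y).
Proof.
move=> b0 hX hY i; apply: le_trans (ler_wpM2r b0 (hX i)).
have h j : normc ((X *m Y) i j) <= \sum_l normc (X i l) * normc (Y l j).
  rewrite mxE; apply: le_trans (normc_sum _ _) _.
  by apply: ler_sum => l _; rewrite normcM.
apply: le_trans (ler_sum _ (fun j _ => h j)) _.
rewrite exchange_big mulr_suml; apply: ler_sum => l _.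
by rewrite -mulr_sumr ler_wpM2l ?normc_ge0.
Qed.

Lemma row_norm_le_trans a b X : a <= b -> row_norm_le a X -> row_norm_le b X.
Proof. by move=> ab hX i; apply: le_trans (hX i) ab. Qed.

Lemma row_norm_le_exp b X N : 0 <= b ->
  row_norm_le b X -> row_norm_le (b ^+ N) (X ^+ N).
Proof.
move=> b0 hX; elim: N => [|N IH]; first exact: row_norm_le1.
by rewrite !exprS; apply: row_norm_leM IH; rewrite // exprn_ge0.
Qed.

(** Telescoping: X^(N+1) - Y^(N+1) = X (X^N - Y^N) + (X - Y) Y^N. Assuming [1 <= b] allows the
    cruder power b^N in place of b^(N-1). *)
Lemma row_norm_le_expB b e X Y N : 1 <= b -> 0 <= e ->
  row_norm_le b X -> row_norm_le b Y -> row_norm_le e (X - Y) ->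
  row_norm_le (N%:R * b ^+ N * e) (X ^+ N - Y ^+ N).
Proof.
move=> b1 e0 hX hY hXY; have b0 : 0 <= b by lra.
elim: N => [|N IH].
  by rewrite subrr !mul0r => i; rewrite big1// => j _; rewrite mxE normc0.
have -> : X ^+ N.+1 - Y ^+ N.+1 = X *m (X ^+ N - Y ^+ N) + (X - Y) *m Y ^+ N.
  by rewrite mulmxBr mulmxBl addrA subrK !exprS.
have h0 : 0 <= b ^+ N by rewrite exprn_ge0.
apply: (@row_norm_le_trans (b * (N%:R * b ^+ N * e) + e * b ^+ N)).
  rewrite -natr1 exprS !mulrDl mul1r.
  rewrite [b * (_ * e)]mulrA [b * (_ * _)]mulrCA lerD2l mulrC ler_wpM2r//.
  by rewrite ler_peMl.
apply: row_norm_leD; apply: row_norm_leM => //.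
  by rewrite mulr_ge0// mulr_ge0.
exact: row_norm_le_exp.
Qed.

Lemma abs_Re_le (z : R[i]) : `|complex.Re z| <= normc z.
Proof. by case: z => x y /=; rewrite -sqrtr_sqr ler_wsqrtr// lerDl sqr_ge0. Qed.

Lemma retr_le a X : row_norm_le a X -> retr X <= m%:R * a.
Proof.
move=> hX; rewrite /retr /mxtrace Re_sum.
have -> : m%:R * a = \sum_(i < m) a by rewrite sumr_const card_ord mulr_natl.
apply: ler_sum => i _; apply: le_trans (le_trans (ler_norm _) (abs_Re_le _)) _.
apply: le_trans (hX i); rewrite (bigD1 i)//= lerDl.
by apply: sumr_ge0 => *; exact: normc_ge0.
Qed.

End row_norm.

Lemma sum_tupleS (V : nmodType) (T : finType) n (F : n.+1.-tuple T -> V) :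
  \sum_(v : n.+1.-tuple T) F v =
  \sum_(x : T) \sum_(v : n.-tuple T) F [tuple of x :: v].
Proof.
rewrite pair_bigA /=.
rewrite (reindex (fun p : T * n.-tuple T => [tuple of p.1 :: p.2]))//.
exists (fun v : n.+1.-tuple T => (thead v, [tuple of behead v])).
  by case=> x v _; congr pair; apply/val_inj.
by move=> v _; rewrite [RHS]tuple_eta; apply/val_inj.
Qed.

(** * A polynomial substitute for the matrix exponential *)

Section exponential_approximation.
Context {R : rcfType} {m : nat}.
Variables (k : nat).
Let N := (2 ^ k)%N.

                              
(** The Euler approximation of exp(- S). The exponent [N] is a power of two so that
    [retr_golden_thompson] applies to it. *)
Definition expNmx (S : 'M[R[i]]_m) : 'M[R[i]]_m :=
  (1%:M - (N%:R^-1)%:C *: S) ^+ N.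

Lemma expNmx0 : retr (expNmx 0) = m%:R.
Proof.
by rewrite /expNmx scaler0 subr0 expr1n /retr mxtrace1 raddfMn.
Qed.

Let N_gt0 : 0 < N%:R :> R. Proof. by rewrite ltr0n expn_gt0. Qed.

(** Dominates the row sums of (1 - S / N)(1 - A / N) and of 1 - (S + A) / N when s + t <= C, while
    its [N]-th power stays below exp(C + t). *)
Definition expN_bound (C t : R) := (1 + C / N%:R) * (1 + t / N%:R).

(** 1 - (S + A) / N and (1 - S / N)(1 - A / N) differ only by S A / N^2. Raising to the power [N]
    multiplies this error by about N, so one Golden-Thompson step costs O(1 / N). *)
Lemma expNmxD_le (C s t : R) (S A : 'M[R[i]]_m) :
  selfadjoint S -> selfadjoint A -> 0 <= s -> 0 <= t -> s + t <= C ->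
  row_norm_le s S -> row_norm_le t A ->
  retr (expNmx (S + A)) <= retr (expNmx S *m expNmx A)
    + m%:R * (expN_bound C t ^+ N * (C * t) / N%:R).
Proof.
move=> hS hA s0 t0 stC bS bA; rewrite /expNmx.
set X := 1%:M - _ *: S; set Y := 1%:M - _ *: A.
set Z := 1%:M - _ *: (S + A).
have hX : selfadjoint X by rewrite /selfadjoint adjmxB adjmxZ adjmx1 hS.
have hY : selfadjoint Y by rewrite /selfadjoint adjmxB adjmxZ adjmx1 hA.
have i0 : 0 <= N%:R^-1 :> R by rewrite invr_ge0 ltW.
have sN0 : 0 <= s / N%:R by rewrite divr_ge0// ltW.
have tN0 : 0 <= t / N%:R by rewrite divr_ge0// ltW.
have CN0 : s / N%:R + t / N%:R <= C / N%:R.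
  by rewrite -mulrDl ler_wpM2r.
have bX : row_norm_le (1 + s / N%:R) X.
  by apply: row_norm_leB row_norm_le1 _; rewrite mulrC; exact: row_norm_leZ.
have bY : row_norm_le (1 + t / N%:R) Y.
  by apply: row_norm_leB row_norm_le1 _; rewrite mulrC; exact: row_norm_leZ.
have b1 : 1 <= expN_bound C t by rewrite /expN_bound; nra.
have bXY : row_norm_le (expN_bound C t) (X *m Y).
  apply: row_norm_le_trans (row_norm_leM _ bX bY); rewrite /expN_bound; nra.
have bZ : row_norm_le (expN_bound C t) Z.
  apply: (@row_norm_le_trans _ _ (1 + (s + t) / N%:R)).
    rewrite /expN_bound mulrDl; nra.
  apply: row_norm_leB row_norm_le1 _; rewrite mulrC; apply: row_norm_leZ => //.
  exact: row_norm_leD.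
have bD : row_norm_le (C * t / N%:R ^+ 2) (Z - X *m Y).
  have -> : Z - X *m Y = - ((N%:R^-1)%:C *: ((N%:R^-1)%:C *: (S *m A))).
    rewrite /Z /X /Y mulmxBl !mulmxBr !mul1mx mulmx1 -scalemxAl -scalemxAr.
    rewrite scalerDr; set a := _ *: S; set b := _ *: A; set c := _ *: _.
    rewrite !opprD !opprK !addrA; apply/matrixP => p q; rewrite !mxE; ring.
  apply/row_norm_leN.
  have -> : C * t / N%:R ^+ 2 = N%:R^-1 * (N%:R^-1 * (C * t)) :> R.
    by field; rewrite gt_eqF.
  do 2![apply: row_norm_leZ => //].
  apply: row_norm_le_trans (row_norm_leM t0 bS bA).
  by rewrite ler_wpM2r//; lra.
have := retr_golden_thompson k hX hY; rewrite -/N => GT.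
have e0 : 0 <= C * t / N%:R ^+ 2.
  by rewrite divr_ge0 ?mulr_ge0 ?sqr_ge0//; lra.
have := retr_le (row_norm_le_expB N b1 e0 bZ bXY bD).
have -> : N%:R * expN_bound C t ^+ N * (C * t / N%:R ^+ 2) =
   expN_bound C t ^+ N * (C * t) / N%:R.
  by field; rewrite gt_eqF.
rewrite retrB lerBlDl => h; apply: le_trans h _.
by rewrite lerD2r.
Qed.

End exponential_approximation.

                                

(** * Rank one matrices built from vectors with unimodular entries *)

Section rank_one.
Context {R : rcfType} {m : nat}.
Hypothesis m_gt0 : (0 < m)%N.
Implicit Type y : 'cV[R[i]]_m.

Let m0 : (m%:R : R) != 0. Proof. by rewrite pnatr_eq0 -lt0n. Qed.

Definition unimodular y := forall i, normc (y i 0) = 1.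

Lemma unimodular_adj y : unimodular y -> adjmx y *m y = (m%:R)%:C%:M.
Proof.
move=> hy; apply/matrixP => i j; rewrite !ord1 !mxE /= mulr1n.
under eq_bigr do rewrite !mxE mulrC mulcJ hy expr1n.
by rewrite sumr_const card_ord -rmorphMn.
Qed.

Lemma unimodular_row_norm y : unimodular y -> row_norm_le m%:R (y *m adjmx y).
Proof.
move=> hy i; rewrite (eq_bigr (fun=> 1)); first by rewrite sumr_const card_ord.
by move=> j _; rewrite !mxE big_ord1 !mxE normcM normc_conjc !hy mulr1.
Qed.

(** Since (y y^H)^2 = m y y^H, the matrices 1 - a y y^H are closed under products; on the line of
    [y] the eigenvalue 1 - c m is raised to the power [N]. *)
Lemma unimodular_exp y (c : R) N : unimodular y ->
  (1%:M - c%:C *: (y *m adjmx y)) ^+ N =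
  1%:M - ((1 - (1 - c * m%:R) ^+ N) / m%:R)%:C *: (y *m adjmx y).
Proof.
move=> hy; set B := y *m adjmx y.
have BB : B *m B = (m%:R)%:C *: B.
  by rewrite /B mulmxA -(mulmxA y) unimodular_adj// mul_mx_scalar scalemxAl.
have mulB (a b : R[i]) : (1%:M - a *: B) *m (1%:M - b *: B) =
    1%:M - (a + b - a * b * (m%:R)%:C) *: B.
  rewrite mulmxBl !mulmxBr !mul1mx mulmx1 -scalemxAl -scalemxAr BB.
  by apply/matrixP => i j; rewrite !mxE; ring.
elim: N => [|N IH]; first by rewrite !expr0 subrr mul0r scale0r subr0.
rewrite exprS IH -mulmxE mulB -!(rmorphM, rmorphD, rmorphB).
by congr (_ - (_)%:C *: _); rewrite exprS; field.
Qed.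

End rank_one.

(** * Mean trace of the approximate exponential over all tuples *)

Section matrix_chernoff_sum.
Context {R : rcfType} {m : nat} {T : finType}.
Hypothesis m_gt0 : (0 < m)%N.
Variable y : T -> 'cV[R[i]]_m.
Hypothesis y_unimodular : forall x, unimodular (y x).
Hypothesis y_frame :
  \sum_x y x *m adjmx (y x) = ((#|T|%:R : R)%:C) *: 1%:M.
Variable k : nat.
Let N := (2 ^ k)%N.
Variable t : R.
Hypotheses (t_ge0 : 0 <= t) (t_le1 : t <= 1).

Let A x : 'M[R[i]]_m := (t / m%:R)%:C *: (y x *m adjmx (y x)).
Let S n (v : n.-tuple T) := \sum_(x <- v) A x.

(** The approximate exponential of one summand [A x] is the identity minus this multiple of y y^H;
    as [N] grows it tends to (1 - exp(- t)) / m. Here [t] is the scale of the summands, later set to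
    1 / 2. *)
Definition chernoff_rate : R := (1 - (1 - t / N%:R) ^+ N) / m%:R.
Let rho := 1 - chernoff_rate.

Let m0 : (0 : R) < m%:R. Proof. by rewrite ltr0n. Qed.
Let N1 : (1 : R) <= N%:R. Proof. by rewrite ler1n expn_gt0. Qed.

Let tN_le1 : 0 <= t / N%:R <= 1.
Proof.
have N0 := lt_le_trans ltr01 N1.
apply/andP; split; first by rewrite divr_ge0// ltW.
by rewrite ler_pdivrMr// mul1r (le_trans t_le1).
Qed.

Let A_selfadjoint x : selfadjoint (A x).
Proof. by rewrite /selfadjoint adjmxZ adjmxM adjmxK. Qed.

Let A_row_norm x : row_norm_le t (A x).
Proof.
rewrite -[X in row_norm_le X](@divfK _ m%:R) ?gt_eqF//.
by apply/row_norm_leZ/unimodular_row_norm; rewrite ?divr_ge0// ltW.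
Qed.

Let expNmx_A x : expNmx k (A x) =
  1%:M - chernoff_rate%:C *: (y x *m adjmx (y x)).
Proof.
rewrite /expNmx /A scalerA -rmorphM.
rewrite (unimodular_exp m_gt0 _ _ (y_unimodular x)).
by congr (_ - (_)%:C *: _); rewrite /chernoff_rate -/N; congr ((1 - (1 - _) ^+ _) / _);
  field; rewrite !gt_eqF// (lt_le_trans ltr01).
Qed.

Lemma chernoff_rate_le1 : 0 <= 1 - chernoff_rate.
Proof.
have [_ h] := andP tN_le1.
rewrite subr_ge0 ler_pdivrMr// mul1r; apply: (@le_trans _ _ 1).
  by rewrite gerBl exprn_ge0// subr_ge0.
by rewrite ler1n.
Qed.

Let rho_ge0 : 0 <= rho. Proof. exact: chernoff_rate_le1. Qed.

Let rho_le1 : rho <= 1.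
Proof.
rewrite gerBl; apply: divr_ge0; last exact: ltW.
rewrite subr_ge0 exprn_ile1//.
  by rewrite subr_ge0; case/andP: tN_le1.
by rewrite gerBl; case/andP: tN_le1.
Qed.

(** Induction on the number of draws, for an arbitrary start [S0]: the first draw is absorbed into
    the start, the induction hypothesis averages over the others, and [expNmxD_le] then splits this
    draw off so that it can be averaged too, gaining one factor [rho]. The constant [C] caps the row
    sums that can accumulate, so that every step has the same error [e]. *)
Lemma sum_expNmx_le (C s : R) n S0 : selfadjoint S0 -> row_norm_le s S0 ->
  0 <= s -> s + n%:R * t <= C ->
  \sum_(v : n.-tuple T) retr (expNmx k (S0 + S v)) <=
  #|T|%:R ^+ n * (rho ^+ n * retr (expNmx k S0)
    + n%:R * (m%:R * (expN_bound k C t ^+ N * (C * t) / N%:R))).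
Proof.
set e := m%:R * _.
elim: n S0 s => [|n IH] S0 s hS bS s0 sC.
  rewrite (big_pred1 [tuple])/=; last first.
    by move=> v; apply/esym/eqP; exact: tuple0.
  by rewrite /S big_nil !expr0 addr0 mul0r !mul1r addr0.
have nt0 : 0 <= n%:R * t by rewrite mulr_ge0.
have e0 : 0 <= e.
  have C0 : 0 <= C by apply: le_trans sC; rewrite addr_ge0// mulr_ge0.
  rewrite /e mulr_ge0// divr_ge0// mulr_ge0 ?mulr_ge0// exprn_ge0//.
  by rewrite /expN_bound mulr_ge0 ?addr_ge0 ?divr_ge0.
rewrite sum_tupleS.
have step x : \sum_(v : n.-tuple T) retr (expNmx k (S0 + S [tuple of x :: v])) <=
    #|T|%:R ^+ n * (rho ^+ n * (retr (expNmx k S0 *m expNmx k (A x)) + e) + n%:R * e).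
  have -> : \sum_(v : n.-tuple T) retr (expNmx k (S0 + S [tuple of x :: v])) =
     \sum_(v : n.-tuple T) retr (expNmx k ((S0 + A x) + S v)).
    by apply: eq_bigr => v _; rewrite /S big_cons addrA.
  apply: le_trans (IH (S0 + A x) (s + t) _ _ _ _) _.
  - by rewrite /selfadjoint adjmxD hS A_selfadjoint.
  - exact: row_norm_leD.
  - exact: addr_ge0.
  - by move: sC; rewrite -natr1; lra.
  rewrite ler_wpM2l ?exprn_ge0// lerD2r ler_wpM2l ?exprn_ge0//.
  have stC : s + t <= C.
    by apply: le_trans sC; rewrite lerD2l ler_peMl// ler1n.
  exact: expNmxD_le hS (A_selfadjoint x) s0 t_ge0 stC bS (A_row_norm x).
apply: le_trans (ler_sum _ (fun x _ => step x)) _.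
rewrite -mulr_sumr !big_split/= -mulr_sumr big_split/= !sumr_const.
(* By the frame identity, the mean of 1 - [chernoff_rate] y y^H is the scalar matrix [rho], which
   leaves the trace. *)
have -> : \sum_(x : T) retr (expNmx k S0 *m expNmx k (A x)) =
    #|T|%:R * (rho * retr (expNmx k S0)).
  rewrite -retr_sum -mulmx_sumr.
  under eq_bigr do rewrite expNmx_A.
  rewrite sumrB sumr_const -scaler_sumr y_frame scalerA.
  have -> : (1%:M *+ #|T| : 'M[R[i]]_m) = (#|T|%:R : R)%:C *: 1%:M.
    by rewrite rmorph_nat scaler_nat.
  rewrite -scalerBl -rmorphM -rmorphB /= -scalemxAr mulmx1 retrZ /rho.
  by move: (chernoff_rate) (retr _) => c q; ring.
rewrite -[e *+ _]mulr_natl -[_ * e *+ _]mulr_natl exprSr -mulrA ler_wpM2l ?exprn_ge0//.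
have r1 : rho ^+ n <= 1 by rewrite exprn_ile1.
rewrite exprSr -natr1 [X in _ <= _ * (_ + X)]mulrDl mul1r.
set q := retr _; set p := rho ^+ n in r1 *.
have distr (a c d r g l : R) : c * (a * (r * d) + a * g) + a * (l * g) =
   a * (c * r * d + (l * g + c * g)) by ring.
by rewrite distr ler_wpM2l// lerD2l lerD2l ler_piMl.
Qed.

(** The bad event: some unit vector has sampled energy at most half of its mean [n]. *)
Definition small_energy n (v : n.-tuple T) := exists2 u : 'cV[R[i]]_m,
  adjmx u *m u = 1%:M &
  \sum_(x <- v) qform (y x *m adjmx (y x)) u <= n%:R / 2.

End matrix_chernoff_sum.

(** * Numerical bounds on the exponential function *)

Section exponential_bounds.
Context {R : realType}.
Implicit Types x u : R.

Lemma exp1DxN_le (N : nat) x : 0 <= x -> (0 < N)%N ->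
  (1 + x / N%:R) ^+ N <= expR x.
Proof.
move=> x0 N0; have N0' : N%:R != 0 :> R by rewrite pnatr_eq0 -lt0n.
have -> : expR x = expR (x / N%:R) ^+ N by rewrite -expRM_natr divfK.
by rewrite lerXn2r ?nnegrE ?expR_ge0 ?addr_ge0 ?divr_ge0// expR_ge1Dx.
Qed.

Lemma exp1BxN_le (N : nat) x : x <= N%:R -> (0 < N)%N ->
  (1 - x / N%:R) ^+ N <= expR (- x).
Proof.
move=> xN N0; have N0' : N%:R != 0 :> R by rewrite pnatr_eq0 -lt0n.
have -> : expR (- x) = expR (- (x / N%:R)) ^+ N.
  by rewrite -expRM_natr mulNr divfK.
rewrite lerXn2r ?nnegrE ?expR_ge0 ?expR_ge1Dx//.
by rewrite subr_ge0 ler_pdivrMr ?mul1r// ltr0n.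
Qed.

(** With u = x / N, it suffices that (1 - u)(1 + 26 u / 25) >= 1, which holds for u <= 1 / 26; the
    hypothesis gives u <= 1 / 28. *)
Lemma exp1BxN_ge (N : nat) x : 0 <= x -> 28 * x <= N%:R -> (0 < N)%N ->
  expR (- (26 / 25 * x)) <= (1 - x / N%:R) ^+ N.
Proof.
move=> x0 xN N0; have N0' : N%:R != 0 :> R by rewrite pnatr_eq0 -lt0n.
have -> : expR (- (26 / 25 * x)) = expR (- (26 / 25 * (x / N%:R))) ^+ N.
  by rewrite -expRM_natr mulNr -!mulrA mulVf ?mulr1.
have u1 : x / N%:R <= 1 / 28 by rewrite ler_pdivrMr ?ltr0n//; lra.
have u0 : 0 <= x / N%:R by rewrite divr_ge0.
move: (x / N%:R) u0 u1 => u u0 u1.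
rewrite lerXn2r ?nnegrE ?expR_ge0//; first by lra.
rewrite expRN -[leRHS]invrK lef_pV2 ?posrE ?expR_gt0 ?invr_gt0//; last by lra.
apply: le_trans (expR_ge1Dx _); rewrite -[leLHS]mul1r ler_pdivrMr; nra.
Qed.

Lemma expRN_half_le : expR (- (1 / 2)) <= (64 / 100 : R).
Proof.
have -> : (1 / 2 : R) = 1 / 4 * 2%:R by lra.
have h := expR_ge1Dx (1 / 4 : R).
rewrite -mulNr expRM_natr expRN exprVn invf_ple ?posrE ?exprn_gt0 ?expR_gt0//.
by apply: le_trans (_ : (1 + 1 / 4) ^+ 2 <= _); [lra|rewrite lerXn2r ?nnegrE ?expR_ge0//; lra].
Qed.

End exponential_bounds.

(** * The matrix Chernoff bound for the smallest eigenvalue *)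

Section matrix_chernoff.
Context {R : realType} {m : nat} {T : finType}.
Hypothesis m_gt0 : (0 < m)%N.
Variable y : T -> 'cV[R[i]]_m.
Hypothesis y_unimodular : forall x, unimodular (y x).
Hypothesis y_frame :
  \sum_x y x *m adjmx (y x) = ((#|T|%:R : R)%:C) *: 1%:M.
Variable n : nat.

Let bad := [set v : n.-tuple T | `[< small_energy y v >]]%SET.
Let x : R := n%:R / m%:R.
Let m0 : (0 : R) < m%:R. Proof. by rewrite ltr0n. Qed.
Let x0 : 0 <= x. Proof. by rewrite divr_ge0. Qed.

(** The factor 1 / 2 is the Chernoff parameter. It gains 1 - exp(- 1 / 2) >= 36 / 100 per unit of
    [x] against a loss of 26 / 100 from the threshold. *)
Let A i : 'M[R[i]]_m := (1 / 2 / m%:R)%:C *: (y i *m adjmx (y i)).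

(** On the bad event the quadratic form of the sum at [u] is at most (1 / (2 m)) (n / 2) = x / 4, so
    that of 1 - S / N is at least 1 - x / (4 N). The trace of an even power dominates the same power
    of this number. *)
Lemma small_energy_retr k (v : n.-tuple T) : small_energy y v ->
  28 * (x / 4) <= (2 ^ k.+1)%:R ->
  expR (- (26 / 25 * (x / 4))) <= retr (expNmx k.+1 (\sum_(i <- v) A i)).
Proof.
move=> [u u1 hu] xN; set S := \sum_(i <- v) A i.
apply: (le_trans (exp1BxN_ge _ xN _)); rewrite ?expn_gt0//.
  by rewrite divr_ge0.
have qS : qform S u <= x / 4.
  have -> : qform S u = 1 / 2 / m%:R * \sum_(i <- v) qform (y i *m adjmx (y i)) u.
    rewrite /S /A -scaler_sumr qformZ; congr (_ * _).
    by rewrite /qform mulmx_sumr mulmx_suml retr_sum.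
  have -> : x / 4 = 1 / 2 / m%:R * (n%:R / 2) by rewrite /x; field; rewrite gt_eqF.
  by apply: ler_wpM2l => //; rewrite !divr_ge0.
have hH : selfadjoint (1%:M - ((2 ^ k.+1)%:R^-1)%:C *: S).
  rewrite /selfadjoint adjmxB adjmx1 adjmxZ adjmx_sum; congr (_ - _ *: _).
  by apply: eq_bigr => i _; rewrite adjmxZ adjmxM adjmxK.
have N0 : (0 : R) < (2 ^ k.+1)%:R by rewrite ltr0n expn_gt0.
have hq : 1 - (x / 4) / (2 ^ k.+1)%:R <= qform (1%:M - ((2 ^ k.+1)%:R^-1)%:C *: S) u.
  rewrite qformB qformZ qform1// lerD2l lerN2 [leLHS]mulrC.
  by rewrite ler_wpM2r // invr_ge0 ltW.
have q0 : 0 <= 1 - (x / 4) / (2 ^ k.+1)%:R.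
  by rewrite subr_ge0 ler_pdivrMr// mul1r; move: xN x0; lra.
apply: le_trans (qform_exp_le_retr k hH u1 (le_trans q0 hq)).
by rewrite lerXn2r ?nnegrE// (le_trans q0).
Qed.

(** The discretisation error without its factor 1 / N, including the exponential from Markov's
    inequality; it does not depend on [k]. *)
Let K : R := expR (26 / 25 * (x / 4)) * n%:R * m%:R *
  expR (n%:R + 1) * (n%:R * (1 / 2)).

(** Markov's inequality in counting form: the trace is nonnegative on every tuple, at least [E] on
    bad ones, and its sum over all tuples is bounded by [sum_expNmx_le]. *)
Lemma small_energy_card_approx k : 28 * (x / 4) <= (2 ^ k.+1)%:R ->
  #|bad|%:R <= #|T|%:R ^+ n *
     (m%:R * expR (- (x / 10)) + K / (2 ^ k.+1)%:R).
Proof.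
move=> xN; set E := expR (- (26 / 25 * (x / 4))).
have N0 : (0 : R) < (2 ^ k.+1)%:R by rewrite ltr0n expn_gt0.
have N1 : (1 : R) <= (2 ^ k.+1)%:R by rewrite ler1n expn_gt0.
have E0 : 0 < E by rewrite expR_gt0.
have t0 : (0 : R) <= 1 / 2 by lra.
have t1 : (1 / 2 : R) <= 1 by lra.
have S0 : selfadjoint (0 : 'M[R[i]]_m).
  by rewrite /selfadjoint; have := adjmxB (0 : 'M[R[i]]_m) 0; rewrite !subrr.
have b0 : row_norm_le 0 (0 : 'M[R[i]]_m).
  by move=> i; rewrite big1// => j _; rewrite mxE normc0.
have C0 : 0 + n%:R * (1 / 2) <= n%:R * (1 / 2) :> R by rewrite add0r.
have := sum_expNmx_le m_gt0 y_unimodular y_frame k.+1 t0 t1 S0 b0 (lexx 0) C0.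
rewrite [X in _ <= _ * (_ * X + _)]expNmx0.
set rho := 1 - chernoff_rate _ _; set ub := expN_bound _ _ _ => hS.
have hbad : #|bad|%:R * E <=
    \sum_(v : n.-tuple T) retr (expNmx k.+1 (0 + \sum_(i <- v) A i)).
  rewrite (bigID (mem bad))/=; apply: ler_wpDr.
    (* An even power of a self-adjoint matrix has the form H H^H, so its trace is nonnegative. *)
    apply: sumr_ge0 => v _; rewrite add0r /expNmx expnS mulnC exprM expr2.
    rewrite -mulmxE; set H := _ ^+ _; have hH : selfadjoint H.
      apply: selfadjoint_exp.
      rewrite /selfadjoint adjmxB adjmx1 adjmxZ adjmx_sum; congr (_ - _ *: _).
      by apply: eq_bigr => i _; rewrite adjmxZ adjmxM adjmxK.
    by rewrite -{2}hH retr_mulmx_adj_ge0.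
  rewrite mulr_natl -sumr_const; apply: ler_sum => v.
  rewrite inE => /asboolP hv; rewrite add0r; exact: small_energy_retr.
have hrho : rho ^+ n <= expR (- (36 / 100 * x)).
  have r : rho <= expR (- (36 / 100 / m%:R)).
    apply: le_trans (expR_ge1Dx _); rewrite lerD2l lerN2.
    apply: ler_wpM2r; first by rewrite invr_ge0 ltW.
    have hN : (1 / 2 : R) <= (2 ^ k.+1)%:R by apply: le_trans N1; lra.
    apply: (@le_trans _ _ (1 - expR (- (1 / 2)))).
      by have := @expRN_half_le R; lra.
    by rewrite lerD2l lerN2 exp1BxN_le ?expn_gt0.
  apply: (@le_trans _ _ (expR (- (36 / 100 / m%:R)) ^+ n)).
    rewrite lerXn2r ?nnegrE ?expR_ge0//.
    exact: (@chernoff_rate_le1 R m m_gt0 k.+1 _ t0 t1).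
  by rewrite -expRM_natr mulNr mulrAC -mulrA -/x.
have hub : ub ^+ (2 ^ k.+1) <= expR (n%:R + 1).
  have c0 : (0 : R) <= n%:R * (1 / 2) by rewrite mulr_ge0.
  rewrite /ub /expN_bound exprMn.
  apply: (@le_trans _ _ (expR (n%:R * (1 / 2)) * expR (1 / 2))).
    by rewrite ler_pM ?exprn_ge0 ?addr_ge0 ?divr_ge0 ?exp1DxN_le ?expn_gt0.
  by rewrite -expRD ler_expR; move: c0; lra.
have -> : #|bad|%:R = #|bad|%:R * E * E^-1 by rewrite mulfK ?gt_eqF.
have GE : E^-1 = expR (26 / 25 * (x / 4)) by rewrite /E expRN invrK.
have G0 : 0 <= E^-1 by rewrite GE expR_ge0.
apply: le_trans (ler_wpM2r G0 (le_trans hbad hS)) _.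
rewrite -[leLHS]mulrA ler_wpM2l ?exprn_ge0// mulrDl lerD//.
  rewrite mulrAC mulrC ler_wpM2l ?ler0n// GE.
  (* The exponents combine to - 36 x / 100 + 26 x / 100 = - x / 10. *)
  apply: le_trans (ler_wpM2r (expR_ge0 _) hrho) _.
  by rewrite -expRD ler_expR; lra.
rewrite /K GE; set G := expR (26 / 25 * _).
have assoc (a b c d g : R) : a * (b * (c / d)) * g = g * a * b * c / d by ring.
rewrite assoc.
rewrite ler_pM2r ?invr_gt0// -[leRHS]mulrA ler_wpM2l//.
  by rewrite !mulr_ge0 ?expR_ge0.
have c0 : (0 : R) <= n%:R * (1 / 2) by rewrite mulr_ge0.
apply: (@le_trans _ _ (ub ^+ (2 ^ k.+1) * (n%:R * (1 / 2)))).
  rewrite ler_wpM2l ?exprn_ge0//; last by lra.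
  by rewrite /ub /expN_bound mulr_ge0 ?addr_ge0 ?divr_ge0.
by rewrite ler_wpM2r.
Qed.

(** Only the error term of [small_energy_card_approx] depends on [k], and it tends to 0. *)
Lemma small_energy_card :
  #|bad|%:R <= #|T|%:R ^+ n * (m%:R * expR (- (x / 10))).
Proof.
apply/ler_addgt0Pr => e e0.
have c0 : 0 <= #|T|%:R ^+ n * K.
  by rewrite mulr_ge0 ?exprn_ge0// /K !mulr_ge0 ?expR_ge0 ?divr_ge0.
have d0 : 0 <= #|T|%:R ^+ n * K / e by rewrite divr_ge0// ltW.
have x40 : 0 <= 28 * (x / 4) by rewrite mulr_ge0// divr_ge0.
have r0 := addr_ge0 x40 d0.
have := archi_boundP r0; set k := Num.bound _ => hk.
have kN : k%:R <= (2 ^ k.+1)%:R :> R.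
  by rewrite ler_nat ltnW// (ltn_trans (ltn_expl k (isT : 1 < 2)%N))// ltn_exp2l.
have N0 : (0 : R) < (2 ^ k.+1)%:R by rewrite ltr0n expn_gt0.
have hkN := ltW (lt_le_trans hk kN).
apply: le_trans (@small_energy_card_approx k _) _.
  by apply: le_trans hkN; rewrite lerDl.
rewrite mulrDr lerD2l mulrA ler_pdivrMr// [leRHS]mulrC -ler_pdivrMr//.
by apply: le_trans hkN; rewrite lerDr.
Qed.

End matrix_chernoff.

                                      

(** * Integrals of cosines and sines over the unit interval *)

Section bounded_integrals.
Context {R : realType}.

Lemma integrable_bounded d (T : measurableType d) (P : probability T R)
    (g : T -> R) (c : R) :
  measurable_fun setT g -> (forall x, `|g x| <= c) ->
  P.-integrable setT (EFin \o g).
Proof.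
move=> mg gc; apply: measurable_bounded_integrable => //.
  by rewrite (le_lt_trans (probability_le1 _ _))// ltry.
exists c; split=> [|M cM x _] /=; first exact: num_real.
exact: le_trans (gc x) (ltW cM).
Qed.

Lemma Rintegral_cst1 d (T : measurableType d) (P : probability T R) (c : R) :
  \int[P]_x c = c.
Proof. by rewrite Rintegral_cst//= (_ : P _ = 1%E) ?mulr1 //; exact: probability_setT. Qed.

Lemma Rintegral_uniform_FTC (g G : R -> R) :
  continuous g -> (forall x, `|g x| <= 1) ->
  (forall x : R, is_derive x (1 : R) G (g x)) ->
  \int[uniform_prob (@ltr01 R)]_x g x = G 1 - G 0.
Proof.
move=> cg g1 dG.
have mg : measurable_fun setT (g : measurableTypeR R -> R).
  exact: continuous_measurable_fun.
have ig := integrable_bounded (uniform_prob (@ltr01 R)) mg g1.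
have i1 : (uniform_prob (@ltr01 R)).-integrable setT (EFin \o cst 1).
  by apply: (@integrable_bounded _ _ _ (cst 1) 1) => // x; rewrite normr1.
(* [integral_uniform] is used for nonnegative integrands, so the constant 1 is added to [g] and
   cancelled at the end. *)
have := RintegralD measurableT i1 ig.
rewrite Rintegral_cst1 => h; apply: (@addrI _ 1); rewrite -h /Rintegral.
have mg1 : measurable_fun setT (fun x : measurableTypeR R => (cst 1 x + g x)%:E).
  by apply/measurable_EFinP/measurable_funD.
have pos x : (0 <= (cst 1 x + g x)%:E)%E.
  by rewrite lee_fin /=; have := g1 x; rewrite ler_norml; lra.
rewrite (integral_uniform _ mg1 pos) subr0 invr1 mul1e.
have dF (x : R) : is_derive x (1 : R) (id \+ G) (1 + g x) by exact: is_deriveD.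
rewrite (@continuous_FTC2 _ _ (id \+ G)) ?ltr01//.
- rewrite /=; lra.
- by apply: continuous_subspaceT => x; apply: cvgD; [exact: cvg_cst|exact: cg].
- have cF x : {for x, continuous (id \+ G)}.
    by apply/differentiable_continuous/derivable1_diffP; case: (dF x).
  split=> [x _||]; first by case: (dF x).
  + exact/cvg_at_right_filter/cF.
  + exact/cvg_at_left_filter/cF.
- by move=> x _; rewrite derive1E; case: (dF x).
Qed.

Lemma cos2pi_int (k : int) : cos (2 * pi * k%:~R) = 1 :> R.
Proof.
have h (n : nat) : cos (2 * pi * n%:R) = 1 :> R.
  rewrite -[RHS]cos0 -(periodicn (@cosD2pi R) n 0) add0r -[_ *+ n]mulr_natr.
  by rewrite mulr2n; congr cos; ring.
case: k => n; first exact: h.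
by rewrite NegzE mulrNz mulrN cosN h.
Qed.

Lemma sin2pi_int (k : int) : sin (2 * pi * k%:~R) = 0 :> R.
Proof.
have h (n : nat) : sin (2 * pi * n%:R) = 0 :> R.
  rewrite -[RHS]sin0 -(periodicn (@sinD2pi R) n 0) add0r -[_ *+ n]mulr_natr.
  by rewrite mulr2n; congr sin; ring.
case: k => n; first exact: h.
by rewrite NegzE mulrNz mulrN sinN h oppr0.
Qed.

Lemma uniform_cos (k : int) :
  \int[uniform_prob (@ltr01 R)]_x cos (2 * pi * k%:~R * x) = (k == 0)%:R.
Proof.
have [->|k0] := eqVneq k 0.
  rewrite (@eq_Rintegral _ _ _ _ _ (cst 1)) ?Rintegral_cst1// => x _.
  by rewrite mulr0 mul0r cos0.
set c := 2 * pi * k%:~R.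
have c0 : c != 0 by rewrite !mulf_neq0 ?intr_eq0// gt_eqF// pi_gt0.
have cg : continuous (fun x : R => cos (c * x)).
  move=> x; apply: continuous_comp; last exact: continuous_cos.
  by apply: cvgM; [exact: cvg_cst|exact: cvg_id].
have g1 (x : R) : `|cos (c * x)| <= 1 by rewrite cos_max.
have dG (x : R) : is_derive x (1 : R) (fun x => sin (c * x) / c) (cos (c * x)).
  apply: is_derive_eq.
  by rewrite /GRing.scale /= !mulr0 ?addr0 ?add0r ?mulr1; field.
by rewrite (Rintegral_uniform_FTC cg g1 dG) mulr1 mulr0 sin0 sin2pi_int !mul0r subrr.
Qed.

Lemma uniform_sin (k : int) :
  \int[uniform_prob (@ltr01 R)]_x sin (2 * pi * k%:~R * x) = 0.
Proof.
have [->|k0] := eqVneq k 0.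
  rewrite (@eq_Rintegral _ _ _ _ _ (cst 0)) ?Rintegral_cst1// => x _.
  by rewrite mulr0 mul0r sin0.
set c := 2 * pi * k%:~R.
have c0 : c != 0 by rewrite !mulf_neq0 ?intr_eq0// gt_eqF// pi_gt0.
have cg : continuous (fun x : R => sin (c * x)).
  move=> x; apply: continuous_comp; last exact: continuous_sin.
  by apply: cvgM; [exact: cvg_cst|exact: cvg_id].
have g1 (x : R) : `|sin (c * x)| <= 1 by rewrite sin_max.
have dG (x : R) : is_derive x (1 : R) (fun x => - cos (c * x) / c) (sin (c * x)).
  apply: is_derive_eq.
  by rewrite /GRing.scale /= !mulr0 ?addr0 ?add0r ?mulr1; field.
by rewrite (Rintegral_uniform_FTC cg g1 dG) mulr1 mulr0 cos0 cos2pi_int subrr.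
Qed.

End bounded_integrals.

(** * Characters of the torus and their integrals *)

Section characters.
Context {R : realType} {d : nat}.
Implicit Types (k l : 'rV[int]_d) (x : d.-tuple R).

Definition phase k x : R := 2 * pi * \sum_(j < d) (k 0 j)%:~R * tnth x j.

Lemma characterE k x : character k x = cos (phase k x) +i* sin (phase k x).
Proof. by []. Qed.

Lemma phaseD k l x : phase (k + l) x = phase k x + phase l x.
Proof.
rewrite /phase -mulrDr -big_split; congr (_ * _).
by apply: eq_bigr => j _; rewrite mxE intrD mulrDl.
Qed.

Lemma phaseN k x : phase (- k) x = - phase k x.
Proof.
rewrite /phase -mulrN -sumrN; congr (_ * _).
by apply: eq_bigr => j _; rewrite mxE intrN mulNr.
Qed.

Lemma characterD k l x : character (k + l) x = character k x * character l x.
Proof.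
rewrite !characterE phaseD cosD sinD; apply/eqP.
by rewrite eq_complex /= eqxx addrC /= addrC [sin _ * _]mulrC eqxx.
Qed.

Lemma characterN k x : character (- k) x = conjc (character k x).
Proof. by rewrite !characterE phaseN cosN sinN. Qed.

Lemma characterB k l x :
  character (k - l) x = character k x * conjc (character l x).
Proof. by rewrite characterD characterN. Qed.

Lemma normc_character k x : normc (character k x) = 1.
Proof. by rewrite characterE /= cos2Dsin2 sqrtr1. Qed.

Lemma measurable_phase k : measurable_fun setT (phase k).
Proof.
apply: measurable_funM => //; apply: measurable_sum => j.
by apply: measurable_funM => //; exact: measurable_tnth.
Qed.

Lemma measurable_cos_phase k : measurable_fun setT (fun x => cos (phase k x)).
Proof.
apply: measurableT_comp; last exact: measurable_phase.
by apply: continuous_measurable_fun; exact: continuous_cos.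
Qed.

Lemma measurable_sin_phase k : measurable_fun setT (fun x => sin (phase k x)).
Proof.
apply: measurableT_comp; last exact: measurable_phase.
by apply: continuous_measurable_fun; exact: continuous_sin.
Qed.

End characters.

Section character_integral.
Context {R : realType}.

Lemma phase_consp d (k : 'rV[int]_d.+1) (x : measurableTypeR R * d.-tuple R) :
  phase k (consp x) = 2 * pi * (k 0 ord0)%:~R * x.1
    + phase (\row_j k 0 (lift ord0 j)) x.2.
Proof.
rewrite /phase big_ord_recl mulrDr; congr (_ + _); first by rewrite !mulrA.
by congr (_ * _); apply: eq_bigr => j _; rewrite mxE /consp tnthS.
Qed.

(** Fubini in the shape of the addition formulas for cosine and sine, in which each term separates
    the first coordinate from the others. *)
Lemma Rintegral_prod_mul d1 d2 (T1 : measurableType d1) (T2 : measurableType d2)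
    (P1 : probability T1 R) (P2 : probability T2 R) (f1 g1 : T1 -> R)
    (f2 g2 : T2 -> R) :
  measurable_fun setT f1 -> measurable_fun setT g1 ->
  measurable_fun setT f2 -> measurable_fun setT g2 ->
  (forall x, `|f1 x| <= 1) -> (forall x, `|g1 x| <= 1) ->
  (forall x, `|f2 x| <= 1) -> (forall x, `|g2 x| <= 1) ->
  \int[(P1 \x P2)%E]_z (f1 z.1 * f2 z.2 + g1 z.1 * g2 z.2) =
  \int[P1]_x f1 x * \int[P2]_x f2 x + \int[P1]_x g1 x * \int[P2]_x g2 x.
Proof.
move=> mf1 mg1 mf2 mg2 bf1 bg1 bf2 bg2.
have if1 := integrable_bounded P1 mf1 bf1.
have ig1 := integrable_bounded P1 mg1 bg1.
have if2 := integrable_bounded P2 mf2 bf2.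
have ig2 := integrable_bounded P2 mg2 bg2.
rewrite {1}/Rintegral -integral12_prod_meas1; last first.
  apply: (@integrable_bounded _ _ _ _ _ 2).
    by apply: measurable_funD; apply: measurable_funM; apply: measurableT_comp.
  move=> z; apply: le_trans (ler_normD _ _) _; rewrite !normrM.
  have := bf1 z.1; have := bg1 z.1; have := bf2 z.2; have := bg2 z.2.
  move: (normr_ge0 (f1 z.1)) (normr_ge0 (g1 z.1)) (normr_ge0 (f2 z.2)) (normr_ge0 (g2 z.2)).
  by nra.
have scale2 (h : T2 -> R) (c : R) : P2.-integrable setT (EFin \o h) ->
    P2.-integrable setT (EFin \o (fun y => c * h y)).
  by move=> ih; apply: eq_integrable (integrableZl measurableT c ih) => // y _;
    rewrite /= EFinM.
have scale1 (h : T1 -> R) (c : R) : P1.-integrable setT (EFin \o h) ->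
    P1.-integrable setT (EFin \o (fun y => h y * c)).
  by move=> ih; apply: eq_integrable (integrableZr measurableT c ih) => // y _;
    rewrite /= EFinM.
transitivity (\int[P1]_x (f1 x * \int[P2]_y f2 y + g1 x * \int[P2]_y g2 y)).
  congr fine; apply: eq_integral => x _; rewrite /fubini_F /=.
  rewrite -(RintegralZl _ _ if2)// -(RintegralZl _ _ ig2)//.
  rewrite -RintegralD//; try exact: scale2.
  rewrite /Rintegral fineK//; apply: integrable_fin_num => //.
  apply: eq_integrable (integrableD measurableT (scale2 _ (f1 x) if2) (scale2 _ (g1 x) ig2)) => //.
rewrite RintegralD//; try exact: scale1.
by rewrite !RintegralZr.
Qed.

Lemma Rintegral_haarS d (g : d.+1.-tuple R -> R) c :
  measurable_fun setT g -> (forall x, `|g x| <= c) ->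
  \int[haar d.+1]_x g x =
  \int[(uniform_prob (@ltr01 R) \x haar d)%E]_z g (consp z).
Proof.
move=> mg bg; rewrite /Rintegral integral_distribution//.
  exact/measurable_EFinP.
have mg' : measurable_fun setT (g \o @consp R d).
  by apply: measurableT_comp => //; exact: measurable_consp.
exact: integrable_bounded mg' (fun z => bg (consp z)).
Qed.

(** Induction on the dimension: the addition formulas split the phase, and the first coordinate
    contributes [uniform_cos] and [uniform_sin]. *)
Lemma haar_character d (k : 'rV[int]_d) :
  \int[haar d]_x cos (phase k x) = (k == 0)%:R :> R /\
  \int[haar d]_x sin (phase k x) = 0 :> R.
Proof.
elim: d k => [k|d IH k].
  have p0 (x : 0.-tuple R) : phase k x = 0 by rewrite /phase big_ord0 mulr0.
  have -> : k = 0 by apply/matrixP => i [].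
  rewrite eqxx; split.
    rewrite (@eq_Rintegral _ _ _ _ _ (cst 1)) ?Rintegral_cst1// => x _.
    by rewrite /phase big_ord0 mulr0 cos0.
  rewrite (@eq_Rintegral _ _ _ _ _ (cst 0)) ?Rintegral_cst1// => x _.
  by rewrite /phase big_ord0 mulr0 sin0.
set k' : 'rV[int]_d := \row_j k 0 (lift ord0 j); have [IHc IHs] := IH k'.
have k0 : (k == 0) = (k 0 ord0 == 0) && (k' == 0).
  apply/eqP/andP => [h|[/eqP k0 /eqP k'0]].
    by split; apply/eqP; [|apply/rowP => j]; rewrite ?mxE h mxE.
  apply/rowP => j; rewrite mxE; have [j' ->|->] := unliftP ord0 j; last by rewrite k0.
  by move/rowP : k'0 => /(_ j'); rewrite !mxE.
have mc : measurable_fun setT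
    (fun x : measurableTypeR R => cos (2 * pi * (k 0 ord0)%:~R * x)).
  apply: measurableT_comp; last exact: measurable_funM.
  by apply: continuous_measurable_fun; exact: continuous_cos.
have ms : measurable_fun setT
    (fun x : measurableTypeR R => sin (2 * pi * (k 0 ord0)%:~R * x)).
  apply: measurableT_comp; last exact: measurable_funM.
  by apply: continuous_measurable_fun; exact: continuous_sin.
set c1 := fun x : measurableTypeR R => _ in mc.
set s1 := fun x : measurableTypeR R => _ in ms.
pose c2 (x : d.-tuple R) := cos (phase k' x).
pose s2 (x : d.-tuple R) := sin (phase k' x).
have mc2 : measurable_fun setT c2 := measurable_cos_phase k'.
have ms2 : measurable_fun setT s2 := measurable_sin_phase k'.
have mN : measurable_fun setT (\- s1) by exact: measurableT_comp.
have bc1 x : `|c1 x| <= 1 by exact: cos_max.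
have bs1 x : `|s1 x| <= 1 by exact: sin_max.
have bN x : `|(\- s1) x| <= 1 by rewrite normrN sin_max.
have bc2 x : `|c2 x| <= 1 by exact: cos_max.
have bs2 x : `|s2 x| <= 1 by exact: sin_max.
set U := uniform_prob (@ltr01 R).
have e1 : \int[U]_x c1 x = (k 0 ord0 == 0)%:R by exact: uniform_cos.
have e2 : \int[U]_x s1 x = 0 by exact: uniform_sin.
split.
  rewrite (Rintegral_haarS (measurable_cos_phase k) (fun x => cos_max (phase k x))).
  transitivity (\int[(U \x haar d)%E]_z (c1 z.1 * c2 z.2 + (\- s1) z.1 * s2 z.2)).
    by apply: eq_Rintegral => z _; rewrite phase_consp cosD /= mulNr.
  rewrite (Rintegral_prod_mul _ _ mc mN mc2 ms2 bc1 bN bc2 bs2).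
  by rewrite IHs mulr0 addr0 IHc e1 -natrM mulnb k0.
rewrite (Rintegral_haarS (measurable_sin_phase k) (fun x => sin_max (phase k x))).
transitivity (\int[(U \x haar d)%E]_z (s1 z.1 * c2 z.2 + c1 z.1 * s2 z.2)).
  by apply: eq_Rintegral => z _; rewrite phase_consp sinD /=.
rewrite (Rintegral_prod_mul _ _ ms mc mc2 ms2 bs1 bc1 bc2 bs2).
by rewrite IHs mulr0 addr0 e2 mul0r.
Qed.

End character_integral.

(** * Linearity of the complex integral *)

Section complex_integral.
Context {R : realType} {d : nat}.
Implicit Types (F G : d.-tuple R -> R[i]) (g h : d.-tuple R -> R).

Lemma ImD (x y : R[i]) : complex.Im (x + y) = complex.Im x + complex.Im y.
Proof. by case: x; case: y. Qed.

Lemma ReM (x y : R[i]) :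
  complex.Re (x * y) = complex.Re x * complex.Re y - complex.Im x * complex.Im y.
Proof. by case: x; case: y. Qed.

Lemma ImM (x y : R[i]) :
  complex.Im (x * y) = complex.Re x * complex.Im y + complex.Im x * complex.Re y.
Proof. by case: x => a b; case: y => a' b' /=; rewrite addrC; ring. Qed.

Definition cintegrable F :=
  (haar d).-integrable setT (fun x => (complex.Re (F x))%:E) /\
  (haar d).-integrable setT (fun x => (complex.Im (F x))%:E).

Lemma cintegralD F G : cintegrable F -> cintegrable G ->
  cintegrable (F \+ G) /\ cintegral (F \+ G) = cintegral F + cintegral G.
Proof.
move=> [iF jF] [iG jG]; split.
  split.
    apply: eq_integrable (integrableD measurableT iF iG) => // x _.
    by rewrite /= ReD.
  apply: eq_integrable (integrableD measurableT jF jG) => // x _.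
  by rewrite /= ImD.
have -> : cintegral (F \+ G) =
    (\int[haar d]_x (complex.Re (F x) + complex.Re (G x))) +i*
    (\int[haar d]_x (complex.Im (F x) + complex.Im (G x))).
  congr (_ +i* _); apply: eq_Rintegral => x _ /=; [exact: ReD|exact: ImD].
by rewrite !RintegralD.
Qed.

Lemma integrable_lin a b g h :
  (haar d).-integrable setT (EFin \o g) -> (haar d).-integrable setT (EFin \o h) ->
  (haar d).-integrable setT (EFin \o (fun x => a * g x + b * h x)) /\
  \int[haar d]_x (a * g x + b * h x) =
  a * \int[haar d]_x g x + b * \int[haar d]_x h x.
Proof.
move=> ig ih.
have ig' : (haar d).-integrable setT (EFin \o (fun x => a * g x)).
  by apply: eq_integrable (integrableZl measurableT a ig).
have ih' : (haar d).-integrable setT (EFin \o (fun x => b * h x)).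
  by apply: eq_integrable (integrableZl measurableT b ih).
split; first by apply: eq_integrable (integrableD measurableT ig' ih').
by rewrite RintegralD// !RintegralZl.
Qed.

Lemma cintegralZ (a : R[i]) F : cintegrable F ->
  cintegrable (fun x => a * F x) /\
  cintegral (fun x => a * F x) = a * cintegral F.
Proof.
move=> [iF jF]; case: a => a b.
have [i1 e1] := integrable_lin a (- b) iF jF.
have [i2 e2] := integrable_lin b a iF jF.
split.
  split; [apply: eq_integrable i1 => // x _|apply: eq_integrable i2 => // x _].
    by rewrite /= ReM mulNr.
  by rewrite /= ImM addrC.
apply/eqP; rewrite eq_complex /=; apply/andP; split; apply/eqP.
  rewrite -mulNr -e1; apply: eq_Rintegral => x _.
  by rewrite ReM mulNr.
by rewrite [RHS]addrC -e2; apply: eq_Rintegral => x _; rewrite ImM addrC.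
Qed.

Lemma cintegral0 :
  cintegrable (fun=> 0) /\ @cintegral R d (fun=> 0) = 0.
Proof.
split; first by split; exact: integrable0.
by rewrite /cintegral !Rintegral_cst1.
Qed.

Lemma cintegral_sum (I : Type) (r : seq I) (a : I -> R[i])
    (F : I -> d.-tuple R -> R[i]) :
  (forall i, cintegrable (F i)) ->
  cintegrable (fun x => \sum_(i <- r) a i * F i x) /\
  cintegral (fun x => \sum_(i <- r) a i * F i x) =
    \sum_(i <- r) a i * cintegral (F i).
Proof.
move=> iF; elim: r => [|i r [IH1 IH2]].
  have -> : (fun x => \sum_(i <- [::]) a i * F i x) = fun=> 0.
    by apply/funext => x; rewrite big_nil.
  by rewrite big_nil; exact: cintegral0.
have -> : (fun x => \sum_(j <- i :: r) a j * F j x) =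
    (fun x => a i * F i x) \+ (fun x => \sum_(j <- r) a j * F j x).
  by apply/funext => x; rewrite big_cons.
have [h1 h2] := cintegralZ (a i) (iF i).
have [h3 h4] := cintegralD h1 IH1.
by split=> //; rewrite h4 h2 IH2 big_cons.
Qed.

Lemma cintegral_conj F : cintegrable F ->
  cintegrable (fun x => conjc (F x)) /\
  cintegral (fun x => conjc (F x)) = conjc (cintegral F).
Proof.
move=> [iF jF]; have [i1 e1] := integrable_lin (-1) 0 jF jF.
split.
  split; first by apply: eq_integrable iF => // x _; rewrite Re_conjc.
  apply: eq_integrable i1 => // x _.
  by rewrite /= mulN1r mul0r addr0; case: (F x).
apply/eqP; rewrite eq_complex /=; apply/andP; split; apply/eqP.
  by apply: eq_Rintegral => x _; rewrite Re_conjc.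
rewrite -mulN1r -[RHS]addr0 -[X in _ + X](mul0r (\int[haar d]_x complex.Im (F x))).
rewrite -e1; apply: eq_Rintegral => x _.
by rewrite /= mulN1r mul0r addr0; case: (F x).
Qed.

Lemma cintegral_character k : cintegrable (@character R d k) /\
  cintegral (@character R d k) = (k == 0)%:R.
Proof.
have [hc hs] := @haar_character R d k; split.
  split; apply: integrable_bounded => [|x].
  - exact: (measurable_cos_phase k).
  - exact: cos_max.
  - exact: (measurable_sin_phase k).
  - exact: sin_max.
rewrite /cintegral; apply/eqP; rewrite eq_complex /=.
have -> : \int[haar d]_x complex.Re (character k x) = (k == 0)%:R :> R by exact: hc.
have -> : \int[haar d]_x complex.Im (character k x) = 0 :> R by exact: hs.
by case: (k == 0); rewrite ?mulr1n ?mulr0n /= !eqxx.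
Qed.

Lemma cintegrable_real g : (haar d).-integrable setT (EFin \o g) ->
  cintegrable (fun x => (g x)%:C) /\
  cintegral (fun x => (g x)%:C) = (\int[haar d]_x g x)%:C.
Proof.
move=> ig; split; first by split=> //=; exact: integrable0.
by rewrite /cintegral /= Rintegral_cst1.
Qed.

End complex_integral.

(** * Pythagoras and Parseval on the torus *)

Section parseval.
Context {R : realType} {d : nat}.
Implicit Types f : d.-tuple R -> R[i].

Lemma L2norm_sqr f : cmeasurable f ->
  (L2norm f ^+ 2 = \int[haar d]_x ((normc (f x)) ^+ 2)%:E)%E.
Proof.
move=> mf; have := @poweR_Lnorm _ _ R (haar d) (EFin \o (@normc R \o f)) 2.
rewrite pnatr_eq0 => /(_ isT) => h.
have -> : (L2norm f ^+ 2 = poweR (L2norm f) 2)%E.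
  have := Lnorm_ge0 (haar d) 2%:E (EFin \o (@normc R \o f)).
  rewrite -/(L2norm f); case: (L2norm f) => [r|_|//].
    by rewrite lee_fin => r0; rewrite poweR_EFin powR_mulrn// EFin_expe.
  by rewrite poweRyr ?pnatr_eq0.
rewrite /L2norm h; apply: eq_integral => x _ /=.
by rewrite ger0_norm ?normc_ge0// powR_mulrn ?normc_ge0.
Qed.

Lemma measurable_normc f : cmeasurable f ->
  measurable_fun setT (fun x => normc (f x) ^+ 2).
Proof.
move=> [mr mi]; apply: eq_measurable_fun (_ : measurable_fun setT
  (fun x => complex.Re (f x) ^+ 2 + complex.Im (f x) ^+ 2)) => [x _|].
  by rewrite normc_sqr.
by apply: measurable_funD; exact: measurable_funX.
Qed.

Lemma square_integrable_sqr f : square_integrable f ->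
  (haar d).-integrable setT (EFin \o (fun x => normc (f x) ^+ 2)).
Proof.
move=> [mf fy]; apply/integrableP; split.
  by apply/measurable_EFinP; exact: measurable_normc.
rewrite (eq_integral (fun x => ((normc (f x)) ^+ 2)%:E)); last first.
  by move=> x _; rewrite gee0_abs// lee_fin sqr_ge0.
rewrite -L2norm_sqr//.
have := Lnorm_ge0 (haar d) 2%:E (EFin \o (@normc R \o f)).
rewrite -/(L2norm f); case: (L2norm f) fy => [r _ _|//|//].
by rewrite -EFin_expe ltry.
Qed.

Lemma abs_Im_le (z : R[i]) : `|complex.Im z| <= normc z.
Proof. by case: z => x y /=; rewrite -sqrtr_sqr ler_wsqrtr// lerDr sqr_ge0. Qed.

Lemma cintegrable_le f (h : d.-tuple R -> R) : cmeasurable f ->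
  (haar d).-integrable setT (EFin \o h) -> (forall x, normc (f x) <= h x) ->
  cintegrable f.
Proof.
move=> [mr mi] ih fh; split; apply: le_integrable ih => //.
- exact/measurable_EFinP.
- move=> x _; rewrite lee_fin /=; apply: le_trans (ler_norm _).
  exact: le_trans (abs_Re_le _) (fh x).
- exact/measurable_EFinP.
- move=> x _; rewrite lee_fin /=; apply: le_trans (ler_norm _).
  exact: le_trans (abs_Im_le _) (fh x).
Qed.

Lemma cintegrable_fourier f k : square_integrable f ->
  cintegrable (fun x => f x * conjc (character k x)).
Proof.
move=> hf; have i2 := square_integrable_sqr hf; have [[mr mi] _] := hf.
have i0 : (haar d).-integrable setT (EFin \o (cst 1 : d.-tuple R -> R)).
  by apply: (@integrable_bounded _ _ _ _ _ 1) => // x; rewrite normr1.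
have [i1 _] := integrable_lin 1 1 i2 i0.
apply: cintegrable_le i1 _; last first.
  move=> x; rewrite normcM normc_conjc normc_character mulr1 /= !mul1r.
  (* Integrability comes from |f| <= |f|^2 + 1 on a probability space. *)
  by have := sqr_ge0 (normc (f x) - 1); have := normc_ge0 (f x); nra.
have mc := measurable_cos_phase k; have ms := measurable_sin_phase k.
split.
  apply: eq_measurable_fun (_ : measurable_fun setT (fun x =>
      complex.Re (f x) * cos (phase k x) + complex.Im (f x) * sin (phase k x))) => [x _|].
    by rewrite ReM /= mulrN opprK.
  by apply: measurable_funD; apply: measurable_funM;
    [exact: mr|exact: mc|exact: mi|exact: ms].
apply: eq_measurable_fun (_ : measurable_fun setT (fun x =>
    complex.Im (f x) * cos (phase k x) - complex.Re (f x) * sin (phase k x))) => [x _|].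
  by rewrite ImM /= mulrN addrC.
by apply: measurable_funB; apply: measurable_funM;
  [exact: mi|exact: mc|exact: mr|exact: ms].
Qed.

Definition trig_poly (K : {fset 'rV[int]_d}) (c : 'rV[int]_d -> R[i]) :
  d.-tuple R -> R[i] := fun x => \sum_(k <- K) c k * character k x.

Lemma cmeasurable_sub_trig_poly K c f : cmeasurable f ->
  cmeasurable (f \- trig_poly K c).
Proof.
move=> [mr mi]; split.
  apply: eq_measurable_fun (_ : measurable_fun setT (fun x => complex.Re (f x) -
     \sum_(k <- K) (complex.Re (c k) * cos (phase k x) - complex.Im (c k) * sin (phase k x))))
     => [x _|].
    by rewrite /= ReB Re_sum; congr (_ - _); apply: eq_bigr => k _; rewrite ReM.
  apply: measurable_funB => //; apply: measurable_sum => k.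
  apply: measurable_funB; apply: measurable_funM => //.
    exact: measurable_cos_phase.
  exact: measurable_sin_phase.
apply: eq_measurable_fun (_ : measurable_fun setT (fun x => complex.Im (f x) -
     \sum_(k <- K) (complex.Re (c k) * sin (phase k x) + complex.Im (c k) * cos (phase k x))))
     => [x _|].
  rewrite /= ImD; congr (_ + _).
  rewrite (_ : complex.Im (- _) = - complex.Im (trig_poly K c x)).
    rewrite /trig_poly (big_morph _ ImD (erefl : complex.Im (0 : R[i]) = 0)).
    by congr (- _); apply: eq_bigr => k _; rewrite ImM.
  by case: (trig_poly _ _ _).
apply: measurable_funB => //; apply: measurable_sum => k.
apply: measurable_funD; apply: measurable_funM => //.
  exact: measurable_sin_phase.
exact: measurable_cos_phase.
Qed.

(** Expand |f - g|^2 = |f|^2 - f conj(g) - conj(f) g + |g|^2, integrate term by term and complete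
    the square in each coefficient. Taking [c] to be the Fourier coefficients gives the error of the
    projection. *)
Lemma pythagoras (K : {fset 'rV[int]_d}) c f : square_integrable f ->
  (haar d).-integrable setT
    (EFin \o (fun x => normc ((f \- trig_poly K c) x) ^+ 2)) /\
  \int[haar d]_x normc ((f \- trig_poly K c) x) ^+ 2 =
  \int[haar d]_x normc (f x) ^+ 2
    - \sum_(k <- K) normc (fourier_coef f k) ^+ 2
    + \sum_(k <- K) normc (c k - fourier_coef f k) ^+ 2.
Proof.
move=> hf; have i2 := square_integrable_sqr hf.
have [iff eff] := cintegrable_real i2.
have iF k := cintegrable_fourier k hf.
have [iP eP] := cintegral_sum K (fun k => - conjc (c k)) iF.
have [iP' eP'] := cintegral_conj iP.
have iC (p : 'rV[int]_d * 'rV[int]_d) := (@cintegral_character R d (p.1 - p.2)).1.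
have [iQ eQ] := cintegral_sum [seq (k, l) | k <- K, l <- K]
  (fun p : 'rV[int]_d * 'rV[int]_d => c p.1 * conjc (c p.2)) iC.
have [i3 e3] := cintegralD iff iP.
have [i4 e4] := cintegralD i3 iP'.
have [i5 e5] := cintegralD i4 iQ.
set G := (X in cintegrable X) in i5.
have GE x : G x = (normc ((f \- trig_poly K c) x) ^+ 2)%:C.
  rewrite -mulcJ /G /=.
  rewrite -mulcJ; set A := \sum_(k <- K) _; set B := \sum_(p <- _) _.
  have -> : B = trig_poly K c x * conjc (trig_poly K c x).
    rewrite /B big_allpairs /= /trig_poly rmorph_sum mulr_suml.
    apply: eq_bigr => k _; rewrite mulr_sumr; apply: eq_bigr => l _.
    by rewrite characterB rmorphM /=; ring.
  have -> : A = - (f x * conjc (trig_poly K c x)).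
    rewrite /A /trig_poly rmorph_sum mulr_sumr -sumrN.
    by apply: eq_bigr => k _; rewrite rmorphM /=; ring.
  by rewrite rmorphN rmorphB rmorphM /= conjcK; ring.
have GI : (haar d).-integrable setT
    (EFin \o (fun x => normc ((f \- trig_poly K c) x) ^+ 2)).
  by apply: eq_integrable i5.1 => // x _; rewrite -/G GE.
split=> //.
have -> : \int[haar d]_x normc ((f \- trig_poly K c) x) ^+ 2 =
   complex.Re (cintegral G).
  by apply: eq_Rintegral => x _; rewrite GE.
rewrite /G e5 e4 e3 eP' eff eP eQ.
set F2 := \sum_(k <- K) normc (fourier_coef f k) ^+ 2.
rewrite big_allpairs /=.
(* Orthogonality of characters leaves only the diagonal l = k. *)
have -> : \sum_(k <- K) \sum_(l <- K) c k * conjc (c l) * cintegral (@character R d (k - l)) =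
   \sum_(k <- K) (normc (c k) ^+ 2)%:C.
  apply: eq_big_seq => k kK; rewrite (big_fsetD1 k)//= big_seq big1.
    by rewrite (cintegral_character _).2 subrr eqxx mulr1 addr0 mulcJ.
  move=> l; rewrite !inE => /andP[lk _].
  by rewrite (cintegral_character _).2 subr_eq0 eq_sym (negbTE lk) mulr0.
rewrite !ReD Re_conjc !Re_sum -!addrA; congr (_ + _).
rewrite /F2 -sumrN -!big_split; apply: eq_bigr => k _.
rewrite -/(fourier_coef f k); move: (fourier_coef f k) => q /=.
by rewrite !normc_sqr; case: (c k) => a b; case: q => u v /=; ring.
Qed.

End parseval.

                                                                

(** * From probabilities of events to counts of index tuples *)

Section uniform_indices.
Context {R : realType} {dO : measure_display} {Omega : measurableType dO}.
Variables (P : probability Omega R) (n M : nat) (idx : 'I_n -> {RV P >-> nat}).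
Hypothesis hindep : mutually_independent idx.
Hypothesis hunif : forall (j : 'I_n) (i : nat), (i < M)%N ->
  distribution P (idx j) [set i] = (M%:R^-1)%:E.

Let cyl (v : 'I_n -> nat) : set Omega :=
  \bigcap_(j in setT) (idx j @^-1` [set v j]).

Let measurable_cyl v : measurable (cyl v).
Proof.
apply: fin_bigcap_measurable => // j _.
by rewrite -[X in measurable X]setTI; exact: measurable_funPT.
Qed.

Let prob_cyl (v : n.-tuple 'I_M) :
  P (cyl (fun j => tnth v j)) = (M%:R^-1 ^+ n)%:E.
Proof.
have -> : cyl (fun j => tnth v j) =
    \bigcap_(j in [set` [set: 'I_n]%SET]) (idx j @^-1` [set (tnth v j : nat)]).
  rewrite (_ : [set` _] = setT)//; apply/seteqP; split => j //= _.
  by rewrite inE.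
rewrite hindep//.
transitivity (\prod_(j < n) (M%:R^-1)%:E : \bar R)%E.
  by apply: eq_big => [j|j _]; [rewrite inE|exact: hunif].
by rewrite prodEFin prodr_const card_ord.
Qed.

(** Any property of the indices is a countable union of cylinders, since they take values in [nat].
    Thus the event of the theorem is measurable without any study of the least squares map. *)
Lemma measurable_indices (Q : ('I_n -> nat) -> Prop) :
  measurable [set w | Q (fun j => idx j w)].
Proof.
have -> : [set w | Q (fun j => idx j w)] =
    \bigcup_(v : n.-tuple nat)
      (if `[< Q (tnth v) >] then cyl (tnth v) else set0).
  apply/seteqP; split => [w Qw|w [v _]].
    exists [tuple idx j w | j < n] => //.
    have -> : tnth [tuple idx j w | j < n] = fun j => idx j w.
      by apply/funext => j; rewrite tnth_mktuple.
    by rewrite asboolT.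
  case: asboolP => // Qv cw /=.
  suff -> : (fun j => idx j w) = tnth v by [].
  by apply/funext => j; exact: cw.
apply: countable_bigcupT_measurable => [|v]; first exact: countableP.
by case: ifP.
Qed.

(** By independence and uniformity each tuple over ['I_M] has a cylinder of probability M^(-n), and
    distinct tuples have disjoint cylinders. *)
Lemma probability_indices_ge (Q : ('I_n -> nat) -> Prop) :
  ((#|[set v : n.-tuple 'I_M | `[< Q (fun j => tnth v j) >]]%SET|%:R
    * M%:R^-1 ^+ n)%:E <= P [set w | Q (fun j => idx j w)])%E.
Proof.
set good := [set v | _]%SET.
pose D := [set` enum good].
have Dfin : finite_set D by exact: finite_seq.
apply: (@le_trans _ _ (P (\bigcup_(v in D) cyl (fun j => tnth v j)))).
  rewrite measure_fin_bigcup//; last first.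
  - move=> v w Dv Dw [x [xv xw]]; apply: eq_from_tnth => j; apply/val_inj.
    exact: etrans (esym (xv j I)) (xw j I).
  - rewrite -fsbig_seq ?enum_uniq// (eq_bigr (fun=> (M%:R^-1 ^+ n)%:E)); last first.
      by move=> v _; exact: prob_cyl.
    by rewrite sumEFin lee_fin big_enum sumr_const mulr_natl.
apply: le_measure; rewrite ?inE.
- by apply: fin_bigcup_measurable.
- exact: measurable_indices.
- move=> x [v Dv xv]; have : v \in enum good by exact: Dv.
  rewrite mem_enum inE => /asboolP Qv /=.
  suff -> : (fun j => idx j x) = (fun j => (tnth v j : nat)) by [].
  by apply/funext => j; exact: xv.
Qed.

End uniform_indices.

(** * A scalar Chernoff-Bernstein bound by counting *)

Section scalar_chernoff.
Context {R : realType} {T : finType}.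

Lemma sum_tuple_prod (F : T -> R) n :
  \sum_(v : n.-tuple T) \prod_(j < n) F (tnth v j) = (\sum_x F x) ^+ n.
Proof.
rewrite -[in RHS](card_ord n) -prodr_const bigA_distr_bigA /=.
rewrite (reindex (fun f : {ffun 'I_n -> T} => [tuple f j | j < n]))/=.
  apply: eq_bigr => f _; apply: eq_bigr => j _; by rewrite tnth_mktuple.
exists (fun v : n.-tuple T => [ffun j => tnth v j]) => [f _|v _].
  by apply/ffunP => j; rewrite ffunE tnth_mktuple.
by apply: eq_from_tnth => j; rewrite tnth_mktuple ffunE.
Qed.

Lemma expR_chord (l x : R) : 0 <= x <= 1 ->
  expR (l * x) <= 1 + (expR l - 1) * x.
Proof.
move=> /andP[x0 x1].
have := @convex_expR R (Itv01 x0 x1) l 0.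
rewrite !convRE /= mulr0 addr0 expR0 mulrC => h.
by apply: le_trans h _; rewrite /unstable.onem; lra.
Qed.

(** Markov's inequality for exp(l sum xi). The sum over tuples factors into an [n]-th power, and
    convexity bounds exp(l x) on [0, 1] by its chord, so that only the mean of [xi] matters. *)
Lemma chernoff_card (xi : T -> R) (mu tau l : R) n :
  0 <= l -> (forall x, 0 <= xi x <= 1) -> \sum_x xi x <= #|T|%:R * mu ->
  #|[set v : n.-tuple T | n%:R * tau < \sum_(j < n) xi (tnth v j)]%SET|%:R <=
  #|T|%:R ^+ n * expR (n%:R * (mu * (expR l - 1) - l * tau)).
Proof.
move=> l0 xi01 ximu; set B := [set v | _]%SET.
have e1 : 0 <= expR l - 1 by rewrite subr_ge0 -expR0 ler_expR.
have mgf : \sum_x expR (l * xi x) <= #|T|%:R * expR (mu * (expR l - 1)).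
  apply: le_trans (_ : #|T|%:R * (1 + (expR l - 1) * mu) <= _); last first.
    by rewrite ler_wpM2l// mulrC expR_ge1Dx.
  apply: le_trans (ler_sum _ (fun x _ => expR_chord l (xi01 x))) _.
  rewrite big_split /= sumr_const -mulr_sumr mulrDr mulr1 lerD2l.
  by rewrite mulrCA ler_wpM2l.
have markov : #|B|%:R * expR (l * (n%:R * tau)) <=
    \sum_(v : n.-tuple T) \prod_(j < n) expR (l * xi (tnth v j)).
  rewrite (bigID (mem B))/=; apply: ler_wpDr.
    by apply: sumr_ge0 => v _; apply: prodr_ge0 => j _; rewrite expR_ge0.
  rewrite mulr_natl -sumr_const; apply: ler_sum => v; rewrite inE => hv.
  by rewrite -expR_sum ler_expR -mulr_sumr ler_wpM2l// ltW.
rewrite (sum_tuple_prod (fun x => expR (l * xi x))) in markov.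
have -> : n%:R * (mu * (expR l - 1) - l * tau) =
    mu * (expR l - 1) * n%:R - l * (n%:R * tau) by ring.
rewrite expRB mulrA ler_pdivlMr ?expR_gt0//.
apply: le_trans markov _; rewrite expRM_natr -exprMn lerXn2r ?nnegrE//.
  by apply: sumr_ge0 => x _; rewrite expR_ge0.
Qed.

Lemma expR1_le : expR (1 : R) <= 29 / 10.
Proof.
have -> : (1 : R) = 1 / 9 * 9%:R by lra.
have h := expR_ge1Dx (- (1 / 9) : R).
have h9 : expR (1 / 9 : R) <= 9 / 8.
  rewrite -[leLHS]invrK -expRN invf_ple ?posrE ?expR_gt0//; lra.
rewrite expRM_natr; apply: (@le_trans _ _ ((9 / 8) ^+ 9)); last by lra.
by rewrite lerXn2r ?nnegrE ?expR_ge0//; lra.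
Qed.

Lemma expR3_2_le : expR (3 / 2 : R) <= 51 / 10.
Proof.
have -> : (3 / 2 : R) = 1 / 8 * 12%:R by lra.
have h := expR_ge1Dx (- (1 / 8) : R).
have h9 : expR (1 / 8 : R) <= 8 / 7.
  rewrite -[leLHS]invrK -expRN invf_ple ?posrE ?expR_gt0//; lra.
rewrite expRM_natr; apply: (@le_trans _ _ ((8 / 7) ^+ 12)); last by lra.
by rewrite lerXn2r ?nnegrE ?expR_ge0//; lra.
Qed.

                                                                             
                                              
(** Two values of [l] suffice. For mu <= 10 q take l = 3 / 2: then r^2 >= (6 / 10) mu^2, and 3 r / 2
    absorbs the excess 11 mu / 10. Otherwise take l = 1: exp(1) <= 29 / 10 leaves mu / 10 to spare,
    more than the missing q / 3. *)
Lemma bernstein_exponent (mu q r : R) : 0 <= mu -> 0 <= q -> 0 <= r ->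
  r ^+ 2 = 6 * q * mu ->
  exists2 l, 0 <= l & mu * (expR l - 1) - l * (2 * mu + r + 2 / 3 * q) <= - q.
Proof.
move=> mu0 q0 r0 r2; have [muq|muq] := lerP mu (10 * q).
  exists (3 / 2); first by lra.
  have h : mu * (11 / 10) <= 3 / 2 * r.
    rewrite -(@ler_pXn2r _ 2)// ?nnegrE ?mulr_ge0//; try lra.
    rewrite !exprMn r2; nra.
  have := expR3_2_le; nra.
exists 1; first by lra.
have := expR1_le; nra.
Qed.

Lemma bernstein_card (xi : T -> R) (mu q r : R) n :
  0 <= mu -> 0 <= q -> 0 <= r -> r ^+ 2 = 6 * q * mu ->
  (forall x, 0 <= xi x <= 1) -> \sum_x xi x <= #|T|%:R * mu ->
  #|[set v : n.-tuple T | n%:R * (2 * mu + r + 2 / 3 * q) <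
       \sum_(j < n) xi (tnth v j)]%SET|%:R <= #|T|%:R ^+ n * expR (- (n%:R * q)).
Proof.
move=> mu0 q0 r0 r2 xi01 ximu.
have [l l0 hl] := bernstein_exponent mu0 q0 r0 r2.
apply: le_trans (chernoff_card _ _ l0 xi01 ximu) _.
by rewrite ler_wpM2l ?exprn_ge0// ler_expR -[leRHS]mulrN ler_wpM2l.
Qed.

End scalar_chernoff.

                      

(** * Least squares under a coercivity bound *)

Section matrix_least_squares.
Context {R : rcfType}.

Definition sqnorm n (v : 'cV[R[i]]_n) : R := \sum_i normc (v i 0) ^+ 2.

Lemma sqnormE n (v : 'cV[R[i]]_n) : sqnorm v = retr (adjmx v *m v).
Proof.
rewrite retrC retr_mulmx_adj; apply: eq_bigr => i _.
by rewrite big_ord1.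
Qed.

Lemma sqnorm_ge0 n (v : 'cV[R[i]]_n) : 0 <= sqnorm v.
Proof. by apply: sumr_ge0 => i _; exact: sqr_ge0. Qed.

Lemma sqnorm_eq0 n (v : 'cV[R[i]]_n) : sqnorm v = 0 -> v = 0.
Proof.
move=> /eqP; rewrite psumr_eq0 => [/allP v0|i _]; last exact: sqr_ge0.
apply/matrixP => i j; rewrite ord1 mxE; apply: eq0_normc; apply/eqP.
by have := v0 i (mem_index_enum i); rewrite /= expf_eq0.
Qed.

(** Coercivity makes the Gram matrix injective, hence invertible. The solution of the normal
    equations has a residual orthogonal to the range of [L], and the identity is Pythagoras. *)
Lemma least_squares_matrix n m (L : 'M[R[i]]_(n, m)) (F : 'cV[R[i]]_n) (a : R) :
  0 < a -> (forall u : 'cV_m, a * sqnorm u <= sqnorm (L *m u)) ->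
  exists c : 'cV_m, forall w : 'cV_m,
    sqnorm (L *m w - F) = sqnorm (L *m (w - c)) + sqnorm (L *m c - F).
Proof.
move=> a0 coer; set G := adjmx L *m L.
have G_unit : G \in unitmx.
  rewrite -row_free_unit; apply/inj_row_free => v vG.
  have : sqnorm (L *m adjmx v) = 0.
    rewrite sqnormE adjmxM adjmxK -mulmxA [adjmx L *m _]mulmxA mulmxA vG.
    by rewrite mul0mx /retr mxtrace0.
  move=> L0; have := coer (adjmx v); rewrite L0 pmulr_rle0// => v0.
  have /sqnorm_eq0 : sqnorm (adjmx v) = 0 by apply/le_anti; rewrite v0 sqnorm_ge0.
  by move/(congr1 (@adjmx _ _ _)); rewrite adjmxK => ->; apply/matrixP => i j;
    rewrite !mxE conjc0.
exists (invmx G *m (adjmx L *m F)) => w; set c := invmx G *m _.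
have ort : adjmx L *m (L *m c - F) = 0.
  by rewrite mulmxBr mulmxA -/G /c mulKVmx// subrr.
have -> : L *m w - F = L *m (w - c) + (L *m c - F).
  by rewrite mulmxBr addrA subrK.
have e1 : adjmx (L *m (w - c)) *m (L *m c - F) = 0.
  by rewrite adjmxM -mulmxA ort mulmx0.
have e2 : adjmx (L *m c - F) *m (L *m (w - c)) = 0.
  rewrite -[LHS]adjmxK adjmxM adjmxK e1; apply/matrixP => i j.
  by rewrite !mxE conjc0.
move: (L *m (w - c)) (L *m c - F) e1 e2 => p q e1 e2.
rewrite !sqnormE adjmxD mulmxDl !mulmxDr !retrD e1 e2.
by rewrite /retr !mxtrace0 addr0 add0r.
Qed.

End matrix_least_squares.

Section trigonometric_least_squares.
Context {R : realType} {d : nat}.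
Variable I : {fset 'rV[int]_d}.
Let m := #|` I|.
Let freq (i : 'I_m) : 'rV[int]_d := nth 0 (enum_fset I) i.

Lemma freq_inj : injective freq.
Proof.
by move=> i j /eqP; rewrite nth_uniq ?fset_uniq// => /eqP; exact: val_inj.
Qed.

Lemma sum_freq (V : nmodType) (F : 'rV[int]_d -> V) :
  \sum_(k <- I) F k = \sum_i F (freq i).
Proof. by rewrite (big_nth 0) big_mkord. Qed.

Definition sampling_matrix n (X : 'I_n -> d.-tuple R) : 'M[R[i]]_(n, m) :=
  \matrix_(j, i) character (freq i) (X j).

Lemma sampling_matrixE n (X : 'I_n -> d.-tuple R) (c : 'rV[int]_d -> R[i]) j :
  (sampling_matrix X *m \col_i c (freq i)) j 0 = trig_poly I c (X j).
Proof.
rewrite mxE /trig_poly sum_freq; apply: eq_bigr => i _.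
by rewrite !mxE mulrC.
Qed.

Lemma col_freq (u : 'cV[R[i]]_m) :
  exists c : 'rV[int]_d -> R[i], u = \col_i c (freq i).
Proof.
exists (fun k => \sum_i (freq i == k)%:R * u i 0).
apply/matrixP => i j; rewrite ord1 mxE (bigD1 i)//= eqxx mul1r big1 ?addr0//.
by move=> l li; rewrite (inj_eq freq_inj) (negbTE li) mul0r.
Qed.

Lemma trig_polyB c b :
  trig_poly I (fun k => c k - b k) = (trig_poly I c \- trig_poly I b : _ -> R[i]).
Proof.
apply/funext => x; rewrite /= /trig_poly -sumrB.
by apply: eq_bigr => k _; rewrite mulrBl.
Qed.

(** The Pythagorean identity bounds the sampled energy of the polynomial with coefficients c - b by
    the residual of [b]; coercivity turns this into a bound on coefficients. Uniqueness is the case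
    of equal residuals. *)
Lemma trig_least_squares n (X : 'I_n -> d.-tuple R) (f : d.-tuple R -> R[i]) a :
  0 < a ->
  (forall c, a * \sum_(k <- I) normc (c k) ^+ 2 <=
     \sum_j normc (trig_poly I c (X j)) ^+ 2) ->
  exists c, unique (least_squares X I f) (trig_poly I c) /\
    forall b, a * \sum_(k <- I) normc (c k - b k) ^+ 2 <=
      \sum_j normc ((f \- trig_poly I b) (X j)) ^+ 2.
Proof.
move=> a0 coer; pose L := sampling_matrix X; pose F := \col_j f (X j).
have sqn (w : 'rV[int]_d -> R[i]) :
    sqnorm (L *m \col_i w (freq i)) = \sum_j normc (trig_poly I w (X j)) ^+ 2.
  by apply: eq_bigr => j _; rewrite sampling_matrixE.
have sqF (w : 'rV[int]_d -> R[i]) :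
    sqnorm (L *m \col_i w (freq i) - F) = residual X f (trig_poly I w).
  apply: eq_bigr => j _; rewrite -sampling_matrixE -/L; congr (normc _ ^+ 2).
  by rewrite [LHS]mxE; congr (_ + _); rewrite !mxE.
have coer' (u : 'cV_m) : a * sqnorm u <= sqnorm (L *m u).
  have [c ->] := col_freq u; rewrite sqn; apply: le_trans (coer c).
  rewrite ler_pM2l// sum_freq /sqnorm.
  by apply: ler_sum => i _; rewrite mxE.
have [c' hc'] := least_squares_matrix F a0 coer'.
have [c cE] := col_freq c'.
have hc w : residual X f (trig_poly I w) =
    \sum_j normc (trig_poly I (fun k => w k - c k) (X j)) ^+ 2
    + residual X f (trig_poly I c).
  have cB : \col_i w (freq i) - \col_i c (freq i) =
      \col_i (w (freq i) - c (freq i)) :> 'cV[R[i]]_m.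
    by apply/matrixP => i j; rewrite !mxE.
  by rewrite -(sqn (fun k => w k - c k)) -!sqF hc' cE cB.
exists c; split.
  split.
    split; first by exists c.
    by move=> _ [w ->]; rewrite -/(trig_poly I w) (hc w) lerDr sumr_ge0// => j _; rewrite sqr_ge0.
  move=> _ [[w ->] /(_ (trig_poly I c))] hw.
  have {}hw := hw (ex_intro _ c erefl).
  rewrite -/(trig_poly I w) (hc w) gerDr in hw.
  have h0 : \sum_(k <- I) normc (w k - c k) ^+ 2 = 0.
    apply/le_anti; rewrite sumr_ge0 ?andbT; last by move=> k _; rewrite sqr_ge0.
    by rewrite -(pmulr_rle0 _ a0) (le_trans (coer _)).
  apply/funext => x; apply: eq_big_seq => k kI; congr (_ * _).
  move/eqP : h0; rewrite psumr_eq0 => [/allP/(_ k kI)|l _]; last exact: sqr_ge0.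
  rewrite /= expf_eq0 /= => /eqP/eq0_normc/eqP; rewrite subr_eq0 => /eqP ->.
  by [].
move=> b; apply: le_trans (coer (fun k => c k - b k)) _.
have := hc b; rewrite {1}/residual => h.
have -> : \sum_j normc ((f \- trig_poly I b) (X j)) ^+ 2 =
    \sum_j normc (trig_poly I b (X j) - f (X j)) ^+ 2.
  by apply: eq_bigr => j _; rewrite -normcN opprB.
rewrite h; apply: (@le_trans _ _ (\sum_j normc (trig_poly I (fun k => b k - c k) (X j)) ^+ 2)).
  apply: ler_sum => j _; rewrite !trig_polyB /= -normcN opprB.
  exact: lexx.
by rewrite lerDl sumr_ge0// => j _; rewrite sqr_ge0.
Qed.

End trigonometric_least_squares.

(** * L2 and supremum norms of trigonometric polynomials *)

Section norms.
Context {R : realType} {d : nat}.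
Implicit Types f g : d.-tuple R -> R[i].

Lemma L2norm_finite g : cmeasurable g ->
  (haar d).-integrable setT (EFin \o (fun x => normc (g x) ^+ 2)) ->
  exists E, [/\ 0 <= E, L2norm g = E%:E &
    E ^+ 2 = \int[haar d]_x normc (g x) ^+ 2].
Proof.
move=> mg ig; have := L2norm_sqr mg.
have -> : (\int[haar d]_x ((normc (g x)) ^+ 2)%:E =
    (\int[haar d]_x normc (g x) ^+ 2)%R%:E)%E.
  by rewrite /Rintegral fineK//; exact: integrable_fin_num.
have := Lnorm_ge0 (haar d) 2%:E (EFin \o (@normc R \o g)).
rewrite -/(L2norm g); case: (L2norm g) => [E|//|//].
rewrite lee_fin -EFin_expe => E0 [EE].
by exists E.
Qed.

Lemma normc_trig_poly_le (K : {fset 'rV[int]_d}) c (x : d.-tuple R) :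
  normc (trig_poly K c x) <= \sum_(k <- K) normc (c k).
Proof.
apply: le_trans (normc_sum _ _) _; apply: ler_sum => k _.
by rewrite normcM normc_character mulr1.
Qed.

Lemma supnorm_ge g x : ((normc (g x))%:E <= supnorm g)%E.
Proof. by apply: ereal_sup_ubound; exists x. Qed.

Lemma supnorm_ge0 g : (0 <= supnorm g)%E.
Proof.
apply: le_trans (supnorm_ge g [tuple 0 | _ < d]).
by rewrite lee_fin normc_ge0.
Qed.

Lemma supnorm_trig_poly (K : {fset 'rV[int]_d}) c :
  exists A : R, [/\ 0 <= A, supnorm (trig_poly K c) = A%:E,
    forall x, normc (trig_poly K c x) <= A & A <= \sum_(k <- K) normc (c k)].
Proof.
have up : (supnorm (trig_poly K c : _ -> R[i]) <= (\sum_(k <- K) normc (c k))%:E)%E.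
  by apply: ge_ereal_sup => _ [x _ <-]; rewrite lee_fin normc_trig_poly_le.
have := supnorm_ge0 (trig_poly K c); have := supnorm_ge (trig_poly K c).
case: (supnorm _) up => [A||]; rewrite ?leye_eq ?leeNy_eq//.
rewrite lee_fin => h1 h2; rewrite lee_fin => h3.
by exists A; split=> // x; rewrite -lee_fin.
Qed.

(** Cauchy-Schwarz against the constant 1, from 2 x y <= x^2 + y^2 summed over all pairs. *)
Lemma sum_sqr_le (T : choiceType) (K : {fset T}) (x : T -> R) :
  (\sum_(k <- K) x k) ^+ 2 <= #|` K|%:R * \sum_(k <- K) x k ^+ 2.
Proof.
set Q := \sum_(k <- K) x k ^+ 2.
have cst (c : R) : \sum_(k <- K) c = #|` K|%:R * c.
  by rewrite big_const_seq count_predT iter_addr_0 mulr_natl.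
have : \sum_(k <- K) \sum_(l <- K) (x k * x l) <=
    \sum_(k <- K) \sum_(l <- K) ((x k ^+ 2 + x l ^+ 2) / 2).
  apply: ler_sum => k _; apply: ler_sum => l _.
  by have := sqr_ge0 (x k - x l); nra.
have -> : \sum_(k <- K) \sum_(l <- K) (x k * x l) = (\sum_(k <- K) x k) ^+ 2.
  by rewrite expr2 mulr_suml; apply: eq_bigr => k _; rewrite mulr_sumr.
have -> : \sum_(k <- K) \sum_(l <- K) ((x k ^+ 2 + x l ^+ 2) / 2) = #|` K|%:R * Q.
  under eq_bigr do rewrite -mulr_suml big_split /= cst.
  by rewrite -mulr_suml big_split /= -mulr_sumr cst -/Q; field.
by [].
Qed.

Lemma sum_fsubset (T : choiceType) (V : nmodType) (I K : {fset T}) (F : T -> V) :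
  fsubset I K ->
  \sum_(k <- K) F k = \sum_(k <- I) F k + \sum_(k <- fsetD K I) F k.
Proof.
move=> IK; rewrite (big_fsetID _ (mem I) K)/=; congr (_ + _).
  congr (\sum_(k <- _) _); congr enum_fset; apply/fsetP => k; rewrite !inE /=.
  by apply/andP/idP => [[]//|kI]; split=> //; exact: (fsubsetP IK).
congr (\sum_(k <- _) _); congr enum_fset; apply/fsetP => k.
by rewrite !inE /= andbC.
Qed.

Lemma fourier_projD (I K : {fset 'rV[int]_d}) f : fsubset I K ->
  fourier_proj K f \- fourier_proj I f =
  trig_poly (fsetD K I) (fourier_coef f) :> (_ -> R[i]).
Proof.
move=> IK; apply/funext => x; rewrite /= /fourier_proj (sum_fsubset _ IK).
by rewrite addrAC subrr add0r.
Qed.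

End norms.

(** * Exact quadrature on the reconstructing lattice *)

Section lattice_sampling.
Context {R : realType} {d : nat}.
Variables (z : 'rV[R]_d) (M : nat) (IM K : {fset 'rV[int]_d}).
Hypotheses (M_gt0 : (0 < M)%N) (hIM : reconstructing z M IM).
Hypothesis KIM : fsubset K IM.

Let pt (i : 'I_M) : d.-tuple R := lattice_point z M i.

(** The entry at (i, j) is the lattice sum of the character of l - k, a frequency in the difference
    set of [IM]. *)
Lemma lattice_gram :
  adjmx (sampling_matrix K pt) *m sampling_matrix K pt = (M%:R : R)%:C *: 1%:M.
Proof.
apply/matrixP => i j; rewrite !mxE.
set k := nth 0 (enum_fset K) i; set l := nth 0 (enum_fset K) j.
have lk : l - k \in difference_set IM.
  apply/imfset2P; exists l; first exact/(fsubsetP KIM)/mem_nth.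
  by exists k => //; exact/(fsubsetP KIM)/mem_nth.
have M0 : (M%:R : R[i]) != 0 by rewrite pnatr_eq0 -lt0n.
have := hIM lk; rewrite subr_eq0 => h.
have -> : (i == j) = (l == k).
  by rewrite /l /k nth_uniq ?fset_uniq// eq_sym.
rewrite rmorph_nat -h mulrA mulfV// mul1r.
by apply: eq_bigr => p _; rewrite !mxE characterB mulrC.
Qed.

Lemma lattice_parseval c :
  \sum_i normc (trig_poly K c (pt i)) ^+ 2 =
  M%:R * \sum_(k <- K) normc (c k) ^+ 2.
Proof.
rewrite sum_freq.
transitivity (sqnorm (sampling_matrix K pt *m \col_i c (nth 0 (enum_fset K) i))).
  by apply: eq_bigr => j _; rewrite sampling_matrixE.
rewrite sqnormE adjmxM -mulmxA [adjmx (sampling_matrix _ _) *m _]mulmxA lattice_gram.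
rewrite -scalemxAl mul1mx -scalemxAr retrZ -sqnormE; congr (_ * _).
by apply: eq_bigr => i _; rewrite mxE.
Qed.

(** The adjoint of a row of the sampling matrix, so that the quadratic form of y y^H at a
    coefficient vector is the squared modulus of the polynomial at the lattice point. *)
Definition lattice_vector (i : 'I_M) : 'cV[R[i]]_#|` K| :=
  adjmx (row i (sampling_matrix K pt)).

Lemma lattice_vector_unimodular i : unimodular (lattice_vector i).
Proof. by move=> k; rewrite !mxE normc_conjc normc_character. Qed.

Lemma lattice_vector_frame :
  \sum_i lattice_vector i *m adjmx (lattice_vector i) =
  ((#|'I_M|%:R : R)%:C) *: 1%:M.
Proof.
rewrite card_ord -lattice_gram; apply/matrixP => k l.
rewrite summxE mxE; apply: eq_bigr => i _.
by rewrite mxE big_ord1 !mxE conjcK.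
Qed.

(** A coefficient vector violating the bound would, after normalisation by the square root of [Q],
    witness [small_energy]. *)
Lemma lattice_coercive n (v : n.-tuple 'I_M) : (0 < n)%N ->
  ~ small_energy lattice_vector v -> forall c,
  n%:R / 2 * \sum_(k <- K) normc (c k) ^+ 2 <=
  \sum_j normc (trig_poly K c (pt (tnth v j))) ^+ 2.
Proof.
move=> n0 hv c; set Q := \sum_(k <- K) _.
have Q0 : 0 <= Q by apply: sumr_ge0 => k _; exact: sqr_ge0.
have [->|Qn0] := eqVneq Q 0.
  by rewrite mulr0 sumr_ge0// => j _; exact: sqr_ge0.
have Qgt0 : 0 < Q by rewrite lt_neqAle eq_sym Qn0.
rewrite leNgt; apply/negP => hlt; apply: hv.
pose s := (Num.sqrt Q)^-1.
have s0 : 0 <= s by rewrite invr_ge0 sqrtr_ge0.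
have s2 : s ^+ 2 * Q = 1 by rewrite exprVn sqr_sqrtr// mulVf.
pose u0 : 'cV[R[i]]_#|` K| := \col_i c (nth 0 (enum_fset K) i).
have nu0 : sqnorm u0 = Q by rewrite /Q sum_freq; apply: eq_bigr => i _; rewrite mxE.
exists (s%:C *: u0).
  have : retr (adjmx u0 *m u0) = Q by rewrite -sqnormE.
  move=> h; rewrite adjmxZ -scalemxAl -scalemxAr scalerA.
  apply/matrixP => i j; rewrite !ord1 mxE.
  have -> : (adjmx u0 *m u0) 0 0 = Q%:C.
    rewrite -nu0 /sqnorm mxE rmorph_sum; apply: eq_bigr => k _.
    by rewrite !mxE mulrC mulcJ.
  by rewrite -!rmorphM /= -expr2 s2 mxE eqxx.
rewrite big_tuple.
have -> : \sum_(j < n) qform (lattice_vector (tnth v j) *m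
    adjmx (lattice_vector (tnth v j))) (s%:C *: u0) =
  s ^+ 2 * \sum_j normc (trig_poly K c (pt (tnth v j))) ^+ 2.
  rewrite mulr_sumr; apply: eq_bigr => j _.
  rewrite /qform /lattice_vector adjmxK -!mulmxA mulmxA -adjmxM -sqnormE.
  rewrite /sqnorm big_ord1 -scalemxAr mxE normcM exprMn normc_real//; congr (_ * normc _ ^+ 2).
  rewrite -row_mul mxE; exact: sampling_matrixE.
apply: le_trans (ler_wpM2l (sqr_ge0 s) (ltW hlt)) _.
by rewrite mulrCA s2 mulr1.
Qed.

End lattice_sampling.

(** * Deterministic error estimate on a good sample *)

Lemma sqr_triangle_le (R : realFieldType) (p g h b : R) :
  0 <= p -> 0 <= g -> 0 <= h -> p <= g + h -> h <= b ->
  p ^+ 2 <= 2 * g ^+ 2 + 2 * b ^+ 2.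
Proof.
move=> p0 g0 h0 pgh hb.
have h1 : p ^+ 2 <= (g + h) ^+ 2 by rewrite lerXn2r ?nnegrE ?addr_ge0.
have h2 : h ^+ 2 <= b ^+ 2 by rewrite lerXn2r ?nnegrE// (le_trans h0).
have := sqr_ge0 (g - h); nra.
Qed.

Section recovery.
Context {R : realType} {d : nat}.
Variables (f : d.-tuple R -> R[i]) (hf : square_integrable f).
Variables (I IM : {fset 'rV[int]_d}) (hI : fsubset I IM).

Lemma L2norm_sub_trig_poly (K : {fset 'rV[int]_d}) c :
  exists e, [/\ 0 <= e, L2norm (f \- trig_poly K c) = e%:E &
    e ^+ 2 = \int[haar d]_x normc (f x) ^+ 2
    - \sum_(k <- K) normc (fourier_coef f k) ^+ 2
    + \sum_(k <- K) normc (c k - fourier_coef f k) ^+ 2].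
Proof.
have [iK eK] := pythagoras K c hf.
have [e [e0 eE e2]] := L2norm_finite (cmeasurable_sub_trig_poly K c hf.1) iK.
by exists e; split=> //; rewrite -eK.
Qed.

Lemma L2norm_sub_fourier_proj (K : {fset 'rV[int]_d}) :
  exists e, [/\ 0 <= e, L2norm (f \- fourier_proj K f) = e%:E &
    e ^+ 2 = \int[haar d]_x normc (f x) ^+ 2
    - \sum_(k <- K) normc (fourier_coef f k) ^+ 2].
Proof.
have [e [e0 eE e2]] := L2norm_sub_trig_poly K (fourier_coef f).
exists e; split=> //; rewrite e2 [X in _ + X]big1 ?addr0// => k _.
by rewrite subrr normc0 expr0n.
Qed.

(** By [pythagoras] the left-hand side is the drop of the squared error from P_I f to P_IM f, and
    the latter error is nonnegative. *)
Lemma bessel_diff e : 0 <= e -> L2norm (f \- fourier_proj I f) = e%:E ->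
  \sum_(k <- fsetD IM I) normc (fourier_coef f k) ^+ 2 <= e ^+ 2.
Proof.
move=> e0 eE; have [e' [_ eE' he']] := L2norm_sub_fourier_proj I.
have [e'' [_ _ h]] := L2norm_sub_fourier_proj IM.
have {}eE : e = e' by apply: EFin_inj; rewrite -eE eE'.
rewrite eE he'; have := sqr_ge0 e''; rewrite {}h (sum_fsubset _ hI); lra.
Qed.

Lemma supnorm_proj_diff_le e s a : 0 <= e -> 0 <= s ->
  L2norm (f \- fourier_proj I f) = e%:E ->
  supnorm (fourier_proj IM f \- fourier_proj I f) = a%:E ->
  s * a <= s * Num.sqrt (#|` fsetD IM I|)%:R * e.
Proof.
move=> e0 s0 eE; rewrite fourier_projD// => aE.
have [a' [a0 aE' _ h]] := supnorm_trig_poly (fsetD IM I) (fourier_coef f).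
have -> : a = a' by apply: EFin_inj; rewrite -aE aE'.
rewrite -mulrA ler_wpM2l//; apply: le_trans h _.
rewrite -(@ler_pXn2r _ 2)// ?nnegrE ?mulr_ge0 ?sqrtr_ge0//; last first.
  by apply: sumr_ge0 => k _; exact: normc_ge0.
apply: le_trans (sum_sqr_le _ _) _.
rewrite exprMn sqr_sqrtr// ler_wpM2l//; exact: bessel_diff.
Qed.

(** The hypothesis on the samples of P_IM f - P_I f is tailored to the square: 8 e^2 + 6 s e a + s^2
    a^2 is (3 e + s a)^2 minus the e^2 contributed by the projection error. *)
Lemma recovery_estimate n (X : 'I_n -> d.-tuple R) (e a s : R) : (0 < n)%N ->
  0 <= e -> 0 <= s -> 0 <= a ->
  L2norm (f \- fourier_proj I f) = e%:E ->
  (forall c, n%:R / 2 * \sum_(k <- I) normc (c k) ^+ 2 <=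
     \sum_j normc (trig_poly I c (X j)) ^+ 2) ->
  4 * \sum_j normc ((fourier_proj IM f \- fourier_proj I f) (X j)) ^+ 2 <=
    n%:R * (8 * e ^+ 2 + 6 * (s * e * a) + s ^+ 2 * a ^+ 2) ->
  exists2 S, unique (least_squares X I f) S &
    (L2norm (f \- S) ^+ 2 <= (3%:E * e%:E + s%:E * a%:E) ^+ 2
      + 4%:E * supnorm (f \- fourier_proj IM f) ^+ 2)%E.
Proof.
move=> n0 e0 s0 a0 eE coer dev; have n0' : (0 : R) < n%:R by rewrite ltr0n.
have n20 : (0 : R) < n%:R / 2 by rewrite divr_gt0.
have [c [uc hc]] := trig_least_squares f n20 coer.
exists (trig_poly I c) => //.
have [e' [_ eE' e2]] := L2norm_sub_fourier_proj I.
have {eE'} ee : e = e' by apply: EFin_inj; rewrite -eE eE'.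
have [ec [_ -> ec2]] := L2norm_sub_trig_poly I c.
rewrite -e2 -ee in ec2; rewrite -!EFinM -EFinD -!EFin_expe.
have := supnorm_ge0 (f \- fourier_proj IM f).
have := supnorm_ge (f \- fourier_proj IM f).
case: (supnorm _) => [b bge|_ _|//]; last first.
  (* If the supremum of f - P_IM f is infinite, so is the right-hand side. *)
  by rewrite expe2 mulyy gt0_muley ?lte_fin// addey// leey.
rewrite lee_fin -EFin_expe -EFinM -EFinD lee_fin ec2 => b0.
have := hc (fourier_coef f); set W := \sum_(k <- I) _ => hW.
have hsum : \sum_j normc ((f \- trig_poly I (fourier_coef f)) (X j)) ^+ 2 <=
    2 * \sum_j normc ((fourier_proj IM f \- fourier_proj I f) (X j)) ^+ 2
      + n%:R * (2 * b ^+ 2).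
  have -> : n%:R * (2 * b ^+ 2) = \sum_(j < n) 2 * b ^+ 2.
    by rewrite sumr_const card_ord mulr_natl.
  rewrite mulr_sumr -big_split; apply: ler_sum => j _ /=.
  have hb := bge (X j); rewrite lee_fin /= in hb.
  have tri : normc (f (X j) - trig_poly I (fourier_coef f) (X j)) <=
     normc (fourier_proj IM f (X j) - fourier_proj I f (X j))
     + normc (f (X j) - fourier_proj IM f (X j)).
    apply: le_trans (le_normcD _ _).
    by rewrite [_ - _ + _]addrC addrA subrK.
  exact: sqr_triangle_le (normc_ge0 _) (normc_ge0 _) (normc_ge0 _) tri hb.
(* After multiplication by [n]: n W <= 2 Y <= 4 G + 4 n b^2, with [Y] the sampled energy of f - P_I
   f and [G] that of P_IM f - P_I f. *)
rewrite -(@ler_pM2l _ n%:R)//.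
move: dev hsum hW; set G := \sum_j normc ((fourier_proj _ _ \- _) _) ^+ 2.
set Y := \sum_j _ => dev hsum hW; nra.
Qed.

End recovery.

(** * Both tail bounds and the conclusion *)

(** [bernstein_card] for xi = g^2 / a^2, with q = 1 / (12 m), mu = e^2 / a^2 and r = 3 s e / (2 a).
    Multiplied by 4 a^2, its threshold 2 mu + r + 2 q / 3 becomes exactly 8 e^2 + 6 s e a + s^2
    a^2. *)
Lemma deviation_card (R : realType) (T : finType) (g : T -> R) (e s a : R)
    (m n : nat) :
  (0 < m)%N -> 0 <= e -> 0 <= s -> 0 <= a -> s ^+ 2 = 2 / (9 * m%:R) ->
  (forall x, 0 <= g x <= a) ->
  \sum_x g x ^+ 2 <= #|T|%:R * e ^+ 2 ->
  #|[set v : n.-tuple T | n%:R * (8 * e ^+ 2 + 6 * (s * e * a) + s ^+ 2 * a ^+ 2)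
      < 4 * \sum_(j < n) g (tnth v j) ^+ 2]%SET|%:R <=
  #|T|%:R ^+ n * expR (- (n%:R / (12 * m%:R))) :> R.
Proof.
move=> m0 e0 s0 a0 s2 ga gsum; set B := [set v | _]%SET.
have m0' : (0 : R) < m%:R by rewrite ltr0n.
(* For a = 0 the normalisation by a^2 is meaningless, but [g] vanishes and no tuple is bad. *)
have [aE|an0] := eqVneq a 0.
  rewrite (_ : B = finset.set0) ?cards0 ?mulr_ge0 ?exprn_ge0 ?expR_ge0//.
  apply/setP => v; rewrite !inE; apply/negbTE; rewrite -leNgt.
  rewrite big1 => [|j _].
    by rewrite mulr0 mulr_ge0// aE !mulr0 expr0n mulr0 !addr0 mulr_ge0// sqr_ge0.
  have := ga (tnth v j); rewrite aE => g0; have -> : g (tnth v j) = 0 by lra.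
  by rewrite expr0n.
have a_gt0 : 0 < a by rewrite lt_neqAle eq_sym an0.
have a2 : 0 < a ^+ 2 by rewrite exprn_gt0.
pose xi x := g x ^+ 2 / a ^+ 2.
pose q : R := 1 / (12 * m%:R); pose mu := e ^+ 2 / a ^+ 2.
pose r := 3 * s * e / (2 * a).
have q0 : 0 <= q by rewrite divr_ge0// mulr_ge0.
have mu0 : 0 <= mu by rewrite divr_ge0// ?sqr_ge0 ?ltW.
have r0 : 0 <= r by rewrite divr_ge0 ?mulr_ge0.
have r2 : r ^+ 2 = 6 * q * mu.
  have -> : r ^+ 2 = s ^+ 2 * (9 * e ^+ 2 / (4 * a ^+ 2)).
    by rewrite /r; field.
  by rewrite s2 /q /mu; field; rewrite an0 gt_eqF.
have xi01 x : 0 <= xi x <= 1.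
  have /andP[g0 g1] := ga x.
  rewrite /xi divr_ge0 ?sqr_ge0//= ler_pdivrMr// mul1r.
  by rewrite lerXn2r ?nnegrE.
have ximu : \sum_x xi x <= #|T|%:R * mu.
  by rewrite -mulr_suml mulrA ler_wpM2r// invr_ge0 ltW.
apply: le_trans (_ : _ <= #|T|%:R ^+ n * expR (- (n%:R * q))) _; last first.
  by rewrite /q mul1r.
apply: le_trans (bernstein_card n mu0 q0 r0 r2 xi01 ximu).
rewrite ler_nat; apply: subset_leq_card; apply/fintype.subsetP => v; rewrite !inE => hv.
rewrite -mulr_suml ltr_pdivlMr//.
rewrite -(@ltr_pM2l _ 4)//; apply: le_lt_trans hv; rewrite le_eqVlt; apply/orP; left.
apply/eqP; rewrite s2 /mu /r /q; field.
by rewrite an0 gt_eqF.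
Qed.

(** With n / m >= 12 (ln m + t), the first exponent is at most ln m - (12 / 10)(ln m + t), strictly
    below - t because t > 0. This strictness makes the final probability bound strict. *)
Lemma sample_size_tails (R : realType) (m n : nat) (t : R) :
  (0 < m)%N -> 0 < t -> 12 * m%:R * (ln m%:R + t) <= n%:R ->
  m%:R * expR (- (n%:R / m%:R / 10)) < expR (- t) /\
  expR (- (n%:R / (12 * m%:R))) <= expR (- t).
Proof.
move=> m0 t0 hn; have m0' : (0 : R) < m%:R by rewrite ltr0n.
have l0 : 0 <= ln m%:R :> R by rewrite ln_ge0// ler1n.
have x12 : 12 * (ln m%:R + t) <= n%:R / m%:R.
  by rewrite ler_pdivlMr// mulrAC.
split; last first.
  rewrite ler_expR lerN2 ler_pdivlMr ?mulr_gt0//.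
  by apply: le_trans hn; rewrite mulrC ler_wpM2l ?mulr_ge0//; lra.
rewrite -{1}[m%:R]lnK ?posrE// -expRD ltr_expR; lra.
Qed.

Local Close Scope complex_scope.

Theorem mainTheorem1 (R : realType) (d : nat) (hd : (0 < d)%N)
    (f : d.-tuple R -> R[i]) (hfT : torus_function f)
    (hf2 : square_integrable f)
    (z : 'rV[R]_d) (M : nat) (hM : (0 < M)%N)
    (IM I : {fset 'rV[int]_d}) (hIM : reconstructing z M IM)
    (hI0 : I != fset0) (hI : fsubset I IM)
    (t : R) (ht : 0 < t) (n : nat)
    (hn : 12 * (#|` I|)%:R * (ln (#|` I|)%:R + t) <= n%:R)
    (dO : measure_display) (Omega : measurableType dO)
    (P : probability Omega R)
    (idx : 'I_n -> {RV P >-> nat})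
    (hindep : mutually_independent idx)
    (hunif : forall (j : 'I_n) (i : nat), (i < M)%N ->
      distribution P (idx j) [set i] = (M%:R^-1)%:E) :
  let X := fun w (j : 'I_n) => lattice_point z M (idx j w) in
  let e := L2norm (f \- fourier_proj I f) in
  let a := supnorm (fourier_proj IM f \- fourier_proj I f) in
  let b := supnorm (f \- fourier_proj IM f) in
  let s := Num.sqrt (2 / (9 * (#|` I|)%:R)) in
  let s' := Num.sqrt (2 * (#|` fsetD IM I|)%:R / (9 * (#|` I|)%:R)) in
  (P [set w | exists2 S : d.-tuple R -> R[i],
        unique (least_squares (X w) I f) S
      & L2norm (f \- S) ^+ 2
          <= (3%:E * e + s%:E * a) ^+ 2 + 4%:E * b ^+ 2
          <= (3 + s')%:E ^+ 2 * e ^+ 2 + 4%:E * b ^+ 2]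
   > (1 - 2 * expR (- t))%:E)%E.
Proof.
cbv zeta; set e := L2norm (f \- fourier_proj I f).
set a := supnorm (fourier_proj IM f \- _).
set b := supnorm (f \- fourier_proj IM f).
set s := Num.sqrt (2 / (9 * _)); set s' := Num.sqrt (2 * _ / _).
pose m := #|` I|.
have m0 : (0 < m)%N by rewrite cardfs_gt0.
have m0' : (0 : R) < m%:R by rewrite ltr0n.
have [tail1 tail2] := sample_size_tails m0 ht hn.
have n0 : (0 < n)%N.
  rewrite -(ltr0n R); apply: lt_le_trans hn; rewrite !mulr_gt0//.
  by rewrite ltr_wpDl// ln_ge0// ler1n.
have [e' [e0 eE _]] := L2norm_sub_fourier_proj hf2 I.
have [a' [a0 aE' ga _]] := supnorm_trig_poly (fsetD IM I) (fourier_coef f).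
have aE : supnorm (fourier_proj IM f \- fourier_proj I f) = a'%:E.
  by rewrite fourier_projD.
have s0 : 0 <= s by exact: sqrtr_ge0.
have s2 : s ^+ 2 = 2 / (9 * m%:R).
  by rewrite sqr_sqrtr// divr_ge0// mulr_ge0.
have s'E : s' = s * Num.sqrt (#|` fsetD IM I|)%:R.
  rewrite /s /s' -sqrtrM; last by rewrite divr_ge0// mulr_ge0.
  by congr Num.sqrt; rewrite mulrAC.
pose D := fsetD IM I.
pose g (i : 'I_M) := normc (trig_poly D (fourier_coef f) (lattice_point z M i)).
pose y := lattice_vector z (M := M) I.
pose bad1 := [set v : n.-tuple 'I_M | `[< small_energy y v >]]%SET.
pose bad2 := [set v : n.-tuple 'I_M |
  n%:R * (8 * e' ^+ 2 + 6 * (s * e' * a') + s ^+ 2 * a' ^+ 2)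
      < 4 * \sum_(j < n) g (tnth v j) ^+ 2]%SET.
have card1 : #|bad1|%:R <=
    M%:R ^+ n * (m%:R * expR (- (n%:R / m%:R / 10))) :> R.
  have := small_energy_card m0 (@lattice_vector_unimodular R d z M I)
    (lattice_vector_frame hM hIM hI) n.
  by rewrite card_ord.
have card2 : #|bad2|%:R <= M%:R ^+ n * expR (- (n%:R / (12 * m%:R))) :> R.
  have gb i : 0 <= g i <= a' by rewrite normc_ge0 ga.
  have gsum : \sum_i g i ^+ 2 <= #|'I_M|%:R * e' ^+ 2.
    (* The difference of the projections has frequencies in IM \ I, so its mean square on the
       lattice is exact and Bessel bounds it by e^2. *)
    rewrite (lattice_parseval hM hIM (fsubsetDl _ _)) card_ord ler_wpM2l//.
    by have := bessel_diff hf2 hI e0 eE.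
  by have := deviation_card n m0 e0 s0 a0 s2 gb gsum; rewrite card_ord.
set E := fun iv : 'I_n -> nat => exists2 S, unique
   (least_squares (fun j => lattice_point z M (iv j)) I f) S
      & (L2norm (f \- S) ^+ 2
          <= (3%:E * e + s%:E * a) ^+ 2 + 4%:E * b ^+ 2
          <= (3 + s')%:E ^+ 2 * e ^+ 2 + 4%:E * b ^+ 2)%E.
have good v : v \notin bad1 -> v \notin bad2 -> E (fun j => tnth v j).
  rewrite !inE => /asboolPn hv; rewrite -leNgt => dev.
  have coer := lattice_coercive n0 hv.
  rewrite -/g -/D in dev.
  have [S uS hS] : exists2 S, unique
     (least_squares (fun j => lattice_point z M (tnth v j)) I f) S &
     (L2norm (f \- S) ^+ 2 <=
       (3%:E * e'%:E + s%:E * a'%:E) ^+ 2 + 4%:E * b ^+ 2)%E.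
    by apply: recovery_estimate => //; rewrite fourier_projD.
  exists S => //; rewrite /e /a eE aE; apply/andP; split=> //.
  rewrite leeD2r//.
  have -> : ((3%:E * e'%:E + s%:E * a'%:E) ^+ 2 =
      ((3 * e' + s * a') ^+ 2)%:E)%E by [].
  rewrite -!EFin_expe -EFinM lee_fin.
  have sa := supnorm_proj_diff_le hf2 hI e0 s0 eE aE.
  rewrite -exprMn lerXn2r ?nnegrE ?addr_ge0 ?mulr_ge0//.
    by rewrite addr_ge0// s'E mulr_ge0// sqrtr_ge0.
  by rewrite [leRHS]mulrDl lerD2l s'E.
apply: (@lt_le_trans _ _ ((#|[set v : n.-tuple 'I_M |
   `[< E (fun j => tnth v j) >]]%SET|%:R * M%:R^-1 ^+ n)%:E)); last first.
  exact: (probability_indices_ge hindep hunif E).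
rewrite lte_fin; set G := [set v | _]%SET.
have Mn0 : (0 : R) < M%:R ^+ n by rewrite exprn_gt0// ltr0n.
(* The union bound: every index tuple is good or lies in one of the two bad sets. *)
have cardG : M%:R ^+ n <= #|G|%:R + #|bad1|%:R + #|bad2|%:R :> R.
  rewrite -!natrD -natrX ler_nat.
  have -> : (M ^ n)%N = #|finset.setTfor (n.-tuple 'I_M)|.
    by rewrite cardsT card_tuple card_ord.
  apply: (@leq_trans #|G :|: bad1 :|: bad2|).
    apply/subset_leq_card/fintype.subsetP => v _; rewrite !finset.in_setU.
    case: (boolP (v \in bad1)) => [|v1]; first by rewrite orbT.
    case: (boolP (v \in bad2)) => [|v2]; first by rewrite orbT.
    by rewrite !orbF inE; apply/asboolP/good.
  apply: leq_trans (leq_card_setU _ _) _; rewrite leq_add2r.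
  exact: leq_card_setU.
rewrite exprVn ltr_pdivlMr//.
have : #|bad1|%:R + #|bad2|%:R < M%:R ^+ n * (2 * expR (- t)) :> R.
  apply: le_lt_trans (lerD card1 card2) _; rewrite -mulrDr ltr_pM2l//; lra.
rewrite mulrBl mul1r [_ * M%:R ^+ n]mulrC; lra.
Qed.
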